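(* Assume $p\neq2$. The Weil representation $\omega_{\psi,X}$ of $\mathrm{Mp}(W)$ can be realised over $\mathcal{L}=\mathcal{K}^{G_{2'}}$, i.e. there exists a smooth representation $\mathcal{V}$ of $\mathrm{Mp}(W)$ over $\mathcal{L}$ such that $\mathcal{V}\otimes_{\mathcal{L}}\mathcal{K}\simeq\omega_{\psi,X}$.
   Context: $F$ is a field of characteristic $\neq 2$ that is either finite of cardinality $q=p^f$ or non-archimedean local with residue field of cardinality $q=p^f$. $R_0$ is $\mathbb{Q}$ or $\mathbb{F}_\ell$ with $\ell\neq p$. $\mathcal{K}=R_0[\zeta_p]$ if $\mathrm{char}(F)>0$ and $\mathcal{K}=R_0[\zeta_{p^\infty}]=\bigcup_kR_0[\zeta_{p^k}]$ if $\mathrm{char}(F)=0$. $G=\mathrm{Gal}(\mathcal{K}/R_0)$ is a subgroup of $(\mathbb{Z}/p\mathbb{Z})^\times$, resp. an open subgroup of $\mathbb{Z}_p^\times$. Write $G=G_2\times G_{2'}$ where $G_2$ is a finite $2$-group and $G_{2'}$ has pro-order prime to $2$; $\mathcal{L}=\mathcal{K}^{G_{2'}}$ is the fixed field of $G_{2'}$, a finite extension of $R_0$. $\psi:F\to\mathcal{K}^\times$ is a non-trivial smooth character. Weil representation. Let $(W,\langle\ ,\ \rangle)$ be a nonzero symplectic $F$-vector space with a complete polarisation $W=X\oplus Y$ (transverse Lagrangians). The Heisenberg group is $H=W\times F$ with law $(w,t)(w',t')=(w+w',t+t'+\frac12\langle w,w'\rangle)$; $\mathrm{Sp}(W)$ acts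 by $g\cdot(w,t)=(gw,t)$. The Heisenberg representation $\rho_\psi$ is realised on $C_c^\infty(Y,\mathcal{K})$ (locally constant compactly supported functions) by $\rho_\psi(x+y,t)f(y')=\psi(t)\psi(\langle y',x\rangle+\frac12\langle y,x\rangle)f(y'+y)$. The metaplectic group $\mathrm{Mp}(W)=\mathrm{Sp}(W)\times_{c_X}\{\pm1\}$ ($c_X$ the $\{\pm1\}$-valued metaplectic cocycle) is, up to isomorphism, the non-trivial topological double cover of $\mathrm{Sp}(W)$ if $F$ is local, and $\mathrm{Sp}(W)\times\{\pm1\}$ if $F$ is finite. The Weil representation $\omega_{\psi,X}$ is the smooth representation of $\mathrm{Mp}(W)$ on $C_c^\infty(Y,\mathcal{K})$ characterised by: the central element $-1$ acts by $-1$; $\omega_{\psi,X}(\tilde g)\rho_\psi(h)\omega_{\psi,X}(\tilde g)^{-1}=\rho_\psi(g\cdot h)$ for $\tilde g$ above $g\in\mathrm{Sp}(W)$ and $h\in H$; and $(n,1)$ above $n\in N(X)$ (unipotent radical of the stabiliser of $X$, which lifts to a subgroup of $\mathrm{Mp}(W)$) acts by $f(y)\mapsto\psi(\frac12\langle by,y\rangle)f(y)$ with $b=(n-\mathrm{id}_W)|_Y:Y\to X$. *)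

(* Defs.v *)
From HB Require Import structures.
From mathcomp Require Import all_boot all_order all_algebra.
From mathcomp Require Import boolp classical_sets functions cardinality.
From mathcomp Require Import topology tvs.
From mathcomp Require Import ring.

Set Implicit Arguments.
Unset Strict Implicit.
Unset Printing Implicit Defensive.

Import Order.TTheory GRing.Theory Num.Theory.

Local Open Scope classical_set_scope.
Local Open Scope ring_scope.

HB.mixin Record TopologicalZmodule_isTopField F
    & GRing.Field F & TopologicalZmodule F := {
  mul_continuous : continuous (fun x : F * F => x.1 * x.2);
  inv_continuous : forall x : F, x != 0 -> {for x, continuous (@GRing.inv F)}
}.

#[short(type="topFieldType")]
HB.structure Definition TopField :=
  {F of GRing.Field F & TopologicalZmodule F
      & TopologicalZmodule_isTopField F}.

HB.mixin Record Group_isTopGroup G & Group G & Topological G := {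
  mulg_continuous : continuous (fun x : G * G => (x.1 * x.2)%g);
  invg_continuous : continuous (fun x : G => (x^-1)%g)
}.

#[short(type="topGroupType")]
HB.structure Definition TopGroup :=
  {G of Group G & Topological G & Group_isTopGroup G}.

Definition locally_constant (T : topologicalType) (A : Type) (f : T -> A) :=
  forall x, \forall y \near x, f y = f x.

Lemma locally_constant_cst (T : topologicalType) (A : Type) (a : A) :
  locally_constant (fun _ : T => a).
Proof. by move=> x; exact: nearW. Qed.

Lemma locally_constant_comp (T U : topologicalType) (A : Type)
    (f : T -> U) (g : U -> A) :
  continuous f -> locally_constant g -> locally_constant (g \o f).
Proof. by move=> fc glc x; exact: (fc x _ (glc (f x))). Qed.

Lemma locally_constant2 (T : topologicalType) (A B C : Type)
    (h : A -> B -> C) (f : T -> A) (g : T -> B) :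
  locally_constant f -> locally_constant g ->
  locally_constant (fun x => h (f x) (g x)).
Proof.
by move=> flc glc x; apply: filterS2 (flc x) (glc x) => y -> ->.
Qed.

Lemma compact_closureS (T : topologicalType) (A B : set T) :
  A `<=` B -> compact (closure B) -> compact (closure A).
Proof.
move=> AB cB; apply: (@subclosed_compact _ _ (closure B)) => //.
  exact: closed_closure.
exact: closureS.
Qed.

Section BaseField.
Variable F : topFieldType.

Definition finite_field (q : nat) : Prop :=
  ([set: F] #= `I_q)%card /\ forall A : set F, open A.

(* [v] is a valuation on the nonzero elements; its value at 0, which would be
   +oo, is irrelevant. *)
Definition vball (v : F -> int) (n : int) : set F :=
  [set x | x = 0 \/ (n <= v x)%R].

Definition discrete_valuation (v : F -> int) : Prop :=
  [/\ exists2 x, x != 0 & v x = 1,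
      forall x y, x != 0 -> y != 0 -> v (x * y) = v x + v y &
      forall x y, x != 0 -> y != 0 -> x + y != 0 ->
        Num.min (v x) (v y) <= v (x + y)].

(* Complete for a normalised discrete valuation which defines the topology,
   with a residue field of cardinality q; the residue field is the set of
   cosets x + m of the maximal ideal m = {v >= 1} in the ring {v >= 0}. *)
Definition local_field (q : nat) : Prop :=
  exists v : F -> int,
  [/\ discrete_valuation v,
      forall A : set F, nbhs (0 : F) A <-> exists n, vball v n `<=` A,
      forall u : nat -> F,
        (forall n : int, exists N : nat, forall i j : nat,
           (N <= i)%N -> (N <= j)%N -> vball v n (u i - u j)) ->
        exists l : F, u @ \oo --> l &
      ([set [set x + y | y in vball v 1] | x in vball v 0] #= `I_q)%card].

(* The canonical topology of a finite-dimensional F-vector space, carried over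
   from that of F^n by coordinates. *)
Definition vcoord (V : vectType F) (v : V) : 'rV[F]_(\dim {:V}) :=
  \row_i coord (vbasis {:V}) i v.

Definition vtop (V : vectType F) : Type := initial_topology (@vcoord V).
HB.instance Definition _ (V : vectType F) :=
  Topological.copy (vtop V) (initial_topology (@vcoord V)).

Lemma vcoord_continuous (V : vectType F) : continuous (@vcoord V : vtop V -> _).
Proof. exact: initial_continuous. Qed.

Lemma vtop_continuous (T : topologicalType) (V : vectType F) (f : T -> vtop V) :
  (forall i, continuous (fun x => coord (vbasis {:V}) i (f x))) -> continuous f.
Proof.
move=> fc.
have vf : continuous (fun x => vcoord (f x)).
  move=> x A [P nP sP].
  have : \forall y \near x, forall i : 'I_(\dim {:V}),
      P 0 i (coord (vbasis {:V}) i (f y)).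
    apply: filter_forall => i; apply: fc.
    by have := nP 0 i; rewrite mxE.
  apply: filterS => y Py; apply: sP => i j.
  by rewrite !ord1 mxE.
apply/continuousP => _ [B Bo <-].
by have /continuousP /(_ B Bo) := vf.
Qed.

Lemma coord_continuous (V : vectType F) i :
  continuous (fun v : vtop V => coord (vbasis {:V}) i v).
Proof.
have -> : (fun v : vtop V => coord (vbasis {:V}) i v) =
    (fun r : 'rV[F]_(\dim {:V}) => r 0 i) \o (@vcoord V : vtop V -> _).
  by apply/funext => v; rewrite /= mxE.
move=> v; apply: continuous_comp; first exact: vcoord_continuous.
move=> A nA; exists (fun _ j => if j == i then A else setT) => [k j|r /(_ 0 i)].
  by rewrite ord1; case: eqP => [->|_] //; exact: filterT.
by rewrite eqxx.
Qed.

Lemma continuousDf (T : topologicalType) (f g : T -> F) :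
  continuous f -> continuous g -> continuous (fun x => f x + g x).
Proof.
move=> fc gc x.
apply: (@continuous_comp _ _ _ (fun x => (f x, g x)) (fun z : F * F => z.1 + z.2)).
  by apply: cvg_pair; [exact: fc|exact: gc].
exact: add_continuous.
Qed.

Lemma continuousMf (T : topologicalType) (f g : T -> F) :
  continuous f -> continuous g -> continuous (fun x => f x * g x).
Proof.
move=> fc gc x.
apply: (@continuous_comp _ _ _ (fun x => (f x, g x)) (fun z : F * F => z.1 * z.2)).
  by apply: cvg_pair; [exact: fc|exact: gc].
exact: mul_continuous.
Qed.

Lemma linear_vtop_continuous (V : vectType F) (u : {linear V -> F^o}) :
  continuous (u : vtop V -> F).
Proof.
have -> : (u : vtop V -> F) =
    fun v => \sum_i coord (vbasis {:V}) i v * u (vbasis {:V})`_i.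
  apply/funext => v; rewrite {1}(coord_vbasis (memvf v)) linear_sum.
  by apply: eq_bigr => i _; rewrite linearZ.
elim: (index_enum _) => [|i s IH].
  have -> : (fun v : vtop V => \sum_(i <- [::])
      coord (vbasis {:V}) i v * u (vbasis {:V})`_i) = fun=> 0.
    by apply/funext => v; rewrite big_nil.
  exact: (@cst_continuous (vtop V) F 0).
under eq_fun do rewrite big_cons.
apply: continuousDf IH; apply: continuousMf; first exact: coord_continuous.
exact: cst_continuous.
Qed.

Lemma translation_vtop_continuous (V : vectType F) (a : V) :
  continuous ((fun y => y + a) : vtop V -> vtop V).
Proof.
apply: vtop_continuous => i.
under eq_fun do rewrite linearD.
by apply: continuousDf; [exact: coord_continuous|exact: cst_continuous].
Qed.

End BaseField.

Record smooth_character (F : topFieldType) (K : fieldType) := SmoothCharacter {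
  schar :> F -> K;
  schar0 : schar 0 = 1;
  scharD : {morph schar : x y / x + y >-> x * y};
  schar_lc : locally_constant schar
}.

Section Schwartz.
Variables (F : topFieldType) (V : vectType F) (K : fieldType).

Definition schwartz_pred : {pred V -> K^o} := fun f =>
  `[< locally_constant (f : vtop V -> K) /\
      compact (closure ([set x | f x != 0] : set (vtop V))) >].

Record schwartz := Schwartz {
  schwartz_val :> V -> K^o;
  _ : schwartz_pred schwartz_val
}.

HB.instance Definition _ := [isSub for schwartz_val].
HB.instance Definition _ := [Choice of schwartz by <:].

Lemma schwartz_submod : submod_closed schwartz_pred.
Proof.
split=> [|a f g /asboolP[flc fc] /asboolP[glc gc]]; apply/asboolP; split.
- exact: (@locally_constant_cst (vtop V) K 0).
- have -> : [set x : vtop V | (0 : V -> K^o) x != 0] = set0.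
    by apply/seteqP; split => x //=; rewrite eqxx.
  by rewrite closure0; exact: compact0.
- exact: (locally_constant2 (fun x y : K => a * x + y) flc glc).
- apply: (@compact_closureS (vtop V) _ ([set x | f x != 0] `|` [set x | g x != 0])).
    move=> x /=; case: (eqVneq (f x) 0) => [fx0|]; last by left.
    case: (eqVneq (g x) 0) => [gx0|]; last by right.
    have -> : (a *: f + g) x = a * f x + g x by [].
    by rewrite fx0 gx0 mulr0 addr0 eqxx.
  by rewrite closureU; exact: compactU.
Qed.
HB.instance Definition _ :=
  GRing.isSubmodClosed.Build K (V -> K^o) schwartz_pred schwartz_submod.
HB.instance Definition _ := [SubChoice_isSubLmodule of schwartz by <:].

End Schwartz.

Section Heisenberg.
Variables (F : topFieldType) (W : vectType F).
Variables (form : {skew_symmetric W}) (X Y : {vspace W}).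

Definition lagrangian (U : {vspace W}) := orthov form U == U.

Definition complete_polarisation : Prop :=
  [/\ lagrangian X, lagrangian Y, (X :&: Y = 0)%VS & (X + Y = fullv)%VS].

Definition heisenberg_mul (h h' : W * F) : W * F :=
  (h.1 + h'.1, h.2 + h'.2 + 2%:R^-1 * form h.1 h'.1).

(* The components of w = x + y along W = X + Y. *)
Definition xpart (w : W) : W := daddv_pi X Y w.
Definition ypart (w : W) : subvs_of Y := vsproj Y (daddv_pi Y X w).

Section Operators.
Variables (K : fieldType) (psi : smooth_character F K).

Definition heisenberg_fun (h : W * F) (f : subvs_of Y -> K) :
    subvs_of Y -> K := fun y' =>
  let x := xpart h.1 in let y := ypart h.1 in
  psi h.2 * psi (form (vsval y') x + 2%:R^-1 * form (vsval y) x) * f (y' + y).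

Lemma heisenberg_schwartz (h : W * F) (f : schwartz (subvs_of Y) K) :
  schwartz_pred (heisenberg_fun h f).
Proof.
have /asboolP[flc fc] := valP f.
pose x := xpart h.1; pose y := ypart h.1.
pose u (y' : subvs_of Y) : F^o := form (vsval y') x.
have ulin : linear u by move=> a v w; rewrite /u linearP linearPl.
pose ul : {linear subvs_of Y -> F^o} :=
  HB.pack u (GRing.isLinear.Build F (subvs_of Y) F^o _ u ulin).
have uc : continuous (u : vtop (subvs_of Y) -> F) :=
  @linear_vtop_continuous F (subvs_of Y) ul.
have trc : continuous ((fun y' => y' + y) : vtop (subvs_of Y) -> vtop (subvs_of Y)).
  exact: translation_vtop_continuous.
apply/asboolP; split.
  apply: (@locally_constant2 (vtop (subvs_of Y)) K K K *%R).
    apply: (@locally_constant2 (vtop (subvs_of Y)) K K K *%R).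
      exact: locally_constant_cst.
    apply: (@locally_constant_comp (vtop (subvs_of Y)) F); last exact: schar_lc.
    exact: (continuousDf uc (@cst_continuous (vtop (subvs_of Y)) F _)).
  exact: locally_constant_comp trc flc.
apply: (@compact_closureS (vtop (subvs_of Y)) _ [set y' | f (y' + y) != 0]).
  by move=> y' /=; apply: contra_neq => fy0; rewrite /heisenberg_fun fy0 mulr0.
set A : set (vtop (subvs_of Y)) := [set x | f x != 0] in fc.
pose B : set (vtop (subvs_of Y)) :=
  ((fun y' => y' + - y) : vtop (subvs_of Y) -> vtop (subvs_of Y)) @` closure A.
have Bc : compact B.
  apply: continuous_compact fc; apply: continuous_subspaceT.
  exact: (@translation_vtop_continuous F (subvs_of Y)).
apply: (@subclosed_compact _ _ B) => //; first exact: closed_closure.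
move=> z cz; exists (z + y); last by rewrite addrK.
move=> U nU; have [w [fw Uw]] := cz _ (trc z U nU).
by exists (w + y).
Qed.

Definition heisenberg_rep (h : W * F) (f : schwartz (subvs_of Y) K) :
    schwartz (subvs_of Y) K :=
  Schwartz (heisenberg_schwartz h f).

End Operators.

Lemma heisenberg_repM (K : fieldType) (psi : smooth_character F K) h h' f :
  2%:R != 0 :> F -> complete_polarisation ->
  heisenberg_rep psi (heisenberg_mul h h') f =
  heisenberg_rep psi h (heisenberg_rep psi h' f).
Proof.
move=> two0 [/eqP lX /eqP lY dXY sXY]; apply/val_inj/funext => z /=.
rewrite /heisenberg_fun /=.
have xD : xpart (h.1 + h'.1) = xpart h.1 + xpart h'.1 by rewrite /xpart linearD.
have yD : ypart (h.1 + h'.1) = ypart h.1 + ypart h'.1.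
  by rewrite /ypart !linearD.
rewrite xD yD.
have wE w : w = xpart w + vsval (ypart w).
  rewrite /xpart /ypart vsprojK ?memv_pi //.
  by rewrite daddv_pi_add // sXY memvf.
have xX w : xpart w \in X by exact: memv_pi.
have XX w w' : w \in X -> w' \in X -> form w w' = 0.
  by move=> wX; rewrite -{1}lX => w'X; apply/eqP; rewrite herm_eq0C;
    apply/eqP; move/mem_orthovP: w'X; apply.
have YY (v w : subvs_of Y) : form (vsval v) (vsval w) = 0.
  have : vsval v \in orthov form Y by rewrite lY subvsP.
  by move/mem_orthovP; apply; exact: subvsP.
have -> : form h.1 h'.1 = form (vsval (ypart h.1)) (xpart h'.1)
    - form (vsval (ypart h'.1)) (xpart h.1).
  rewrite {1}(wE h.1) {1}(wE h'.1) linearDl !linearDr /= XX // YY addr0 add0r.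
  by rewrite addrC; congr (_ + _); rewrite hermC expr1 mulN1r.
rewrite [in LHS]addrA -!scharD !mulrA -!scharD; congr (psi _ * _).
rewrite [vsval (_ + _)]linearD /= !linearDl !linearDr /=.
by field.
Qed.

Definition Sp : set 'End(W) := [set g | isometry form form g].

(* The unipotent radical of the stabiliser of a Lagrangian X: the elements of
   Sp(W) acting trivially on X and on W/X. *)
Definition NX : set 'End(W) :=
  [set n | [/\ Sp n, forall x, x \in X -> n x = x & forall w, n w - w \in X]].

End Heisenberg.

Section Metaplectic.
Variables (F : topFieldType) (W : vectType F).
Variables (form : {skew_symmetric W}) (X : {vspace W}).
Variable Mp : topGroupType.

(* Sp(W) has the topology induced by that of End(W). *)
Local Notation EndW := (vtop 'End(W)).

Definition homomorphic_section (pr : Mp -> 'End(W)) (s : 'End(W) -> Mp) : Prop :=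
  (forall g, Sp form g -> pr (s g) = g) /\
  (forall g h, Sp form g -> Sp form h -> s (g \o h)%VF = (s g * s h)%g).

(* [Mp] is the double cover Sp(W) x_c {1, -1}, where [pr] is the projection to
   Sp(W), [eps] is the central element (1, -1), [s g] is (g, 1) and the cocycle
   c is given by s g * s h = c(g, h) s (g h). As c is only determined up to
   the isomorphism class of the double cover, it is required to be trivial on
   N(X) and to define the split cover if F is finite, and the topologically
   non-split one if F is local. *)
Record metaplectic (pr : Mp -> 'End(W)) (eps : Mp) (s : 'End(W) -> Mp) : Prop := {
  mp_hausdorff : hausdorff_space Mp;
  mp_prM : forall a b, pr (a * b)%g = (pr a \o pr b)%VF;
  mp_range : range pr = Sp form;
  mp_ker : forall a, pr a = \1%VF <-> a = 1%g \/ a = eps;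
  mp_eps : eps != 1%g;
  mp_continuous : continuous (pr : Mp -> EndW);
  mp_open : forall A : set Mp, open A ->
    exists2 B : set EndW, open B & pr @` A = B `&` Sp form;
  mp_section : forall g, Sp form g -> pr (s g) = g;
  mp_NX : forall n n', NX form X n -> NX form X n' ->
    s (n \o n')%VF = (s n * s n')%g;
  mp_finite : forall q, finite_field F q ->
    exists s' : 'End(W) -> Mp, homomorphic_section pr s';
  mp_local : forall q, local_field F q ->
    ~ exists2 s' : 'End(W) -> Mp, homomorphic_section pr s' &
        {within (Sp form : set EndW), continuous (s' : EndW -> Mp)}
}.

End Metaplectic.

Section Representations.
Variables (G : topGroupType) (K : fieldType).

Definition representation (V : lmodType K) (pi : G -> V -> V) : Prop :=
  [/\ forall g, linear (pi g), forall v, pi 1%g v = v &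
      forall g h v, pi (g * h)%g v = pi g (pi h v)].

Definition smooth_representation (V : lmodType K) (pi : G -> V -> V) : Prop :=
  representation pi /\ forall v, open [set g | pi g v = v].

Definition isomorphic_representations (V V' : lmodType K)
    (pi : G -> V -> V) (pi' : G -> V' -> V') : Prop :=
  exists phi : V -> V', [/\ linear phi, bijective phi &
    forall g v, phi (pi g v) = pi' g (phi v)].

End Representations.

Section ExtensionOfScalars.
Variables (L K : fieldType) (j : {rmorphism L -> K}) (V : lmodType L).

Definition balanced (U : zmodType) (t : V -> K -> U) : Prop :=
  [/\ forall c, {morph t^~ c : v w / v + w},
      forall v, {morph t v : c d / c + d} &
      forall a v c, t (a *: v) c = t v (j a * c)].

(* [T] with t(v, c) = v (x) c is the tensor product of V and K over L, with its
   structure of K-vector space. *)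
Definition tensor_product (T : lmodType K) (t : V -> K -> T) : Prop :=
  [/\ balanced t, forall d v c, t v (d * c) = d *: t v c &
      forall (U : zmodType) (u : V -> K -> U), balanced u ->
        exists! h : T -> U, {morph h : x y / x + y} /\
          forall v c, h (t v c) = u v c].

End ExtensionOfScalars.

(* [omega] is isomorphic to the extension of scalars of [pi] along j. *)
Definition extension_of_scalars_isomorphic (G : topGroupType)
    (L K : fieldType) (j : {rmorphism L -> K})
    (V : lmodType L) (pi : G -> V -> V)
    (S : lmodType K) (omega : G -> S -> S) : Prop :=
  exists (T : lmodType K) (t : V -> K -> T) (tau : G -> T -> T),
  [/\ tensor_product j t, representation tau,
      forall g v c, tau g (t v c) = t (pi g v) c &
      isomorphic_representations tau omega].

(* The properties characterising the Weil representation omega_{psi, X}. *)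
Definition weil_representation (F : topFieldType) (W : vectType F)
    (form : {skew_symmetric W}) (X Y : {vspace W}) (Mp : topGroupType)
    (pr : Mp -> 'End(W)) (eps : Mp) (s : 'End(W) -> Mp)
    (K : fieldType) (psi : smooth_character F K)
    (omega : Mp -> schwartz (subvs_of Y) K -> schwartz (subvs_of Y) K) : Prop :=
  [/\ smooth_representation omega,
      forall f, omega eps f = - f,
      forall g h f, omega g (heisenberg_rep form X psi h (omega (g^-1)%g f)) =
        heisenberg_rep form X psi (pr g h.1, h.2) f &
      forall n f y, NX form X n ->
        omega (s n) f y =
        psi (2%:R^-1 * form (n (vsval y) - vsval y) (vsval y)) * f y].

(* R_0 = Q or F_l. *)
Definition prime_field (l : option nat) : fieldType :=
  if l is Some l' then 'F_l' else rat.

Section Galois.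
Variables (R0 K : fieldType) (iota : {rmorphism R0 -> K}).

(* K is generated over R_0 by the roots of unity of order p^k, for k in A. *)
Definition cyclotomic_extension (p : nat) (A : set nat) : Prop :=
  (forall k, A k -> exists z : K, (p ^ k)%N.-primitive_root z) /\
  (forall x : K, exists k (z : K) (P : {poly R0}),
     [/\ A k, (p ^ k)%N.-primitive_root z & x = (map_poly iota P).[z]]).

Definition galois_group : set (K -> K) :=
  [set g : K -> K | [/\ bijective g, zmod_morphism g, monoid_morphism g &
    forall a, g (iota a) = iota a]].

Implicit Types H U : set (K -> K).

Definition subgroup H : Prop :=
  [/\ H id, forall g h, H g -> H h -> H (g \o h) &
      forall g, H g -> exists h, [/\ H h, cancel g h & cancel h g]].

(* Closed for the Krull topology, for which the pointwise stabilisers of the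
   finite subsets of K are a basis of neighbourhoods of id. *)
Definition closed_subgroup H : Prop :=
  [/\ subgroup H, H `<=` galois_group &
      forall g, galois_group g ->
        (forall r : seq K, exists2 h, H h & {in r, g =1 h}) -> H g].

Definition open_subgroup H U : Prop :=
  [/\ subgroup U, U `<=` H &
      exists r : seq K, forall g, H g -> {in r, g =1 id} -> U g].

Definition left_cosets H U : set (set (K -> K)) :=
  [set [set g \o u | u in U] | g in H].

Definition pro_order_prime_to (l : nat) H : Prop :=
  forall U, open_subgroup H U ->
    exists2 n, coprime n l & (left_cosets H U #= `I_n)%card.

(* G = G_2 x G_2', with G_2 a finite 2-group and G_2' of pro-order prime to 2. *)
Definition decomposition_2_2' (G2 G2' : set (K -> K)) : Prop :=
  [/\ closed_subgroup G2, closed_subgroup G2',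
      forall g h, G2 g -> G2' h -> g \o h = h \o g,
      G2 `&` G2' = [set id] &
      galois_group = [set g \o h | g in G2 & h in G2'] ] /\
  (exists a, (G2 #= `I_(2 ^ a))%card) /\ pro_order_prime_to 2 G2'.

Definition fixed_field H : set K := [set x | forall g, H g -> g x = x].

End Galois.

(* K = R_0[zeta_p] if char(F) > 0, and K = R_0[zeta_(p^oo)] if char(F) = 0. *)
Definition coefficient_field (F : fieldType) (p : nat) (R0 K : fieldType)
    (iota : {rmorphism R0 -> K}) : Prop :=
  ([pchar F] =i pred0 -> cyclotomic_extension iota p setT) /\
  (forall l, l \in [pchar F] -> cyclotomic_extension iota p [set 1%N]).

(* Main.v *)
(* Galois descent.  For g in G2' there is b_g in F^* with g (psi x) = psi (b_g x)
   for all x, so that g^2 multiplies the argument of psi by the square b_g^2.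
   The g^2-semilinear operator R_g f (y) = g^2 (f (b_g^-1 y)) then satisfies
   R_g rho (w, t) = rho (b_g w, b_g^2 t) R_g.  By Schur's lemma it commutes with
   omega up to a character of Mp(W), which is trivial: it is so on -1 and on N(X),
   whose conjugates contain the transvections, which generate Sp(W).  Letting g
   act on K by g^2 has the same fixed field L since G2' has odd pro-order, and
   each f is fixed by R_g for g close to 1; thus the vectors fixed by all R_g form
   an L-structure on the Schwartz space which is stable under omega. *)

Require Import Defs.
From HB Require Import structures.
From mathcomp Require Import all_boot all_order all_algebra.
From mathcomp Require Import boolp classical_sets functions cardinality.
From mathcomp Require Import topology tvs.
From mathcomp Require Import ring zify.

Set Implicit Arguments.
Unset Strict Implicit.
Unset Printing Implicit Defensive.

Import Order.TTheory GRing.Theory Num.Theory.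
Local Open Scope classical_set_scope.
Local Open Scope ring_scope.

(** * Galois descent *)

(** Scalars are the similitudes of W that commute with Sp(W), and the scalar b has similitude factor
    b^2: this is why g^2 replaces g. The factor b_g is the image in F of the exponents by which g
    acts on roots of unity: a single integer if p = 0 in F, and otherwise a limit of integers, which
    exists because p is topologically nilpotent and F is complete. Since psi is non-trivial, b_g is
    unique, hence multiplicative in g; as the Galois group is abelian, squaring is multiplicative
    too. So the R_g form a true action, not merely a projective one, and no cocycle obstructs
    descent. The extension K/L may be infinite. Descent still works because each f is fixed by every
    R_g with g fixing one suitable root of unity z, so that only the finitely many conjugates of z
    matter. *)

Section GaloisDescent.
Variables (L K : fieldType) (j : {rmorphism L -> K}).
Variables (V : lmodType L) (S : lmodType K) (i : V -> S).
Hypothesis iD : {morph i : v w / v + w}.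
Hypothesis iZ : forall a v, i (a *: v) = j a *: i v.
Hypothesis i_inj : injective i.
Variables (I : Type) (sg : I -> K -> K) (R : I -> S -> S).
Hypothesis sg0 : forall t, sg t 0 = 0.
Hypothesis sg1 : forall t, sg t 1 = 1.
Hypothesis RD : forall t, {morph R t : f g / f + g}.
Hypothesis RZ : forall t c f, R t (c *: f) = sg t c *: R t f.
Hypothesis Ri : forall t v, R t (i v) = i v.
Hypothesis sg_fix : forall x, (forall t, sg t x = x) -> exists a, x = j a.
Hypothesis i_span : forall f, exists s : seq (V * K),
  f = \sum_(x <- s) x.2 *: i x.1.

Let i0 : i 0 = 0.
Proof. by have := iZ 0 0; rewrite scaler0 rmorph0 scale0r. Qed.

Let i_sum (J : Type) (s : seq J) (F : J -> V) :
  i (\sum_(k <- s) F k) = \sum_(k <- s) i (F k).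
Proof. exact: (big_morph _ iD i0). Qed.

Let R_sum t (J : Type) (s : seq J) (F : J -> S) :
  R t (\sum_(k <- s) F k) = \sum_(k <- s) R t (F k).
Proof.
apply: (big_morph _ (RD t)).
by have := RZ t 0 0; rewrite scaler0 sg0 scale0r.
Qed.

Section Relations.
Variables (U : zmodType) (u : V -> K -> U).
Hypothesis u_bal : balanced j u.

Let uD c : {morph u^~ c : v w / v + w}. Proof. by have [h _ _] := u_bal; exact: h. Qed.
Let uDr v : {morph u v : c d / c + d}. Proof. by have [_ h _] := u_bal; exact: h. Qed.
Let uZ a v c : u (a *: v) c = u v (j a * c). Proof. by have [_ _ h] := u_bal. Qed.

Let u0r v : u v 0 = 0.
Proof. by apply: (@addrI _ (u v 0)); rewrite -uDr !addr0. Qed.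

Let u0l c : u 0 c = 0.
Proof. by apply: (@addrI _ (u 0 c)); rewrite -uD !addr0. Qed.

Let uNr v c : u v (- c) = - u v c.
Proof. by apply: (@addrI _ (u v c)); rewrite -uDr !subrr u0r. Qed.

(* Induction on the support D of the relation c: unless c is proportional to a
   relation over L, subtracting from c / c_a its conjugate writes c as a sum of
   two relations with smaller supports. *)
Lemma balanced_relation n (v : 'I_n -> V) (c : 'I_n -> K) :
  \sum_k c k *: i (v k) = 0 -> \sum_k u (v k) (c k) = 0.
Proof.
have: forall k, k \notin [set: 'I_n]%SET -> c k = 0 by move=> k; rewrite inE.
have [m] := ubnP #|[set: 'I_n]%SET|; elim: m [set: 'I_n]%SET c => // m IH D c.
rewrite ltnS => Dm cD c0.
case: (pselect (exists a, c a != 0)) => [[a ca]|]; last first.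
  move=> nc; rewrite big1// => k _.
  have [->//|ck] := eqVneq (c k) 0.
  by case: nc; exists k.
have aD : a \in D by apply: contraNT ca => /cD ->.
pose d k := c k / c a.
have d0 : \sum_k d k *: i (v k) = 0.
  transitivity ((c a)^-1 *: (\sum_k c k *: i (v k))); last by rewrite c0 scaler0.
  by rewrite scaler_sumr; apply: eq_bigr => k _; rewrite scalerA mulrC.
case: (pselect (forall k, exists l, d k = j l)) => [/choice[l dl]|/existsNP[b nb]].
  have l0 : \sum_k l k *: v k = 0.
    apply: i_inj; rewrite i_sum i0 -[RHS]d0.
    by apply: eq_bigr => k _; rewrite iZ dl.
  transitivity (u (\sum_k l k *: v k) (c a)); last by rewrite l0 u0l.
  rewrite (big_morph _ (uD (c a)) (u0l (c a))).
  by apply: eq_bigr => k _; rewrite uZ -dl divfK.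
have [t tb] : exists t, sg t (d b) != d b.
  apply: contrapT => nt; apply: nb; apply: sg_fix => t.
  by apply: contrapT => /eqP tb; apply: nt; exists t.
pose e k := sg t (d k) - d k.
have ea : e a = 0 by rewrite /e /d divff// sg1 subrr.
have eb : e b != 0 by rewrite subr_eq0.
have e0 : \sum_k e k *: i (v k) = 0.
  transitivity (R t (\sum_k d k *: i (v k)) - \sum_k d k *: i (v k)).
    rewrite R_sum -sumrB; apply: eq_bigr => k _.
    by rewrite RZ Ri scalerBl.
  by rewrite d0 subr0; have := RZ t 0 0; rewrite scaler0 sg0 scale0r.
have eD k : k \notin D -> e k = 0.
  by move=> /cD ck; rewrite /e /d ck mul0r sg0 subrr.
have bD : b \in D by apply: contraNT eb => /eD ->.
(* The factor makes [g b = c b], so [c - g] vanishes at [b], while [g] vanishes at [a] like [e]. *)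
pose g k := c b / e b * e k.
have g0 : \sum_k g k *: i (v k) = 0.
  under eq_bigr do rewrite /g -scalerA.
  by rewrite -scaler_sumr e0 scaler0.
have smaller x : x \in D -> (#|D :\ x|%SET < m)%N.
  by move=> xD; apply: leq_trans Dm; rewrite [leqRHS](cardsD1 x) xD.
have g1 : \sum_k u (v k) (g k) = 0.
  apply: (IH (D :\ a)%SET) g0; first exact: smaller.
  move=> k; rewrite !inE negb_and negbK => /orP[/eqP->|/eD ek].
    by rewrite /g ea mulr0.
  by rewrite /g ek mulr0.
have cg1 : \sum_k u (v k) (c k - g k) = 0.
  apply: (IH (D :\ b)%SET); first exact: smaller.
    move=> k; rewrite !inE negb_and negbK => /orP[/eqP->|kD].
      by rewrite /g divfK// subrr.
    by rewrite /g (eD k)// (cD k)// mulr0 subrr.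
  under eq_bigr do rewrite scalerBl.
  by rewrite sumrB c0 g0 subrr.
transitivity (\sum_k u (v k) (c k - g k) + \sum_k u (v k) (g k)); last first.
  by rewrite cg1 g1 addr0.
rewrite -big_split /=; by apply: eq_bigr => k _; rewrite -uDr subrK.
Qed.

Lemma balanced_relation_seq (s : seq (V * K)) :
  \sum_(x <- s) x.2 *: i x.1 = 0 -> \sum_(x <- s) u x.1 x.2 = 0.
Proof.
rewrite !(big_nth (0, 0)) !big_mkord => h.
exact: (@balanced_relation _ (fun k => (nth (0, 0) s k).1)
                             (fun k => (nth (0, 0) s k).2)).
Qed.

(** The difference of two expressions of one vector is a relation. This makes the map induced by [u]
    on [S] well defined. *)
Lemma balanced_relation_eq (s s' : seq (V * K)) :
  \sum_(x <- s) x.2 *: i x.1 = \sum_(x <- s') x.2 *: i x.1 ->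
  \sum_(x <- s) u x.1 x.2 = \sum_(x <- s') u x.1 x.2.
Proof.
move=> h; apply/eqP; rewrite -subr_eq0; apply/eqP.
have neg (A : zmodType) (F : V -> K -> A) : (forall v c, F v (- c) = - F v c) ->
    \sum_(x <- s ++ [seq (x.1, - x.2) | x <- s']) F x.1 x.2 =
    \sum_(x <- s) F x.1 x.2 - \sum_(x <- s') F x.1 x.2.
  move=> FN; rewrite big_cat big_map /= -sumrN; congr (_ + _).
  by apply: eq_bigr => x _; rewrite FN.
rewrite -(neg _ _ uNr); apply/balanced_relation_seq.
rewrite (neg _ (fun v c => c *: i v)) ?h ?subrr// => v c.
by rewrite scaleNr.
Qed.

End Relations.

(** [S] itself is the tensor product. The induced map is computed on a chosen expression of each
    vector; its additivity follows from independence of the choice, its uniqueness from [i_span]. *)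
Lemma descent_tensor_product : tensor_product j (fun v c => c *: i v).
Proof.
split.
- split=> [c v w|v c d|a v c] /=; first by rewrite iD scalerDr.
    by rewrite scalerDl.
  by rewrite iZ scalerA mulrC.
- by move=> d v c; rewrite scalerA.
move=> U u u_bal; have [rep repE] := choice i_span.
have [_ uDr _] := u_bal.
exists (fun f => \sum_(x <- rep f) u x.1 x.2); split.
  split=> [f g|v c].
    rewrite -big_cat; apply: balanced_relation_eq => //.
    by rewrite big_cat -!repE.
  transitivity (\sum_(x <- [:: (v, c)]) u x.1 x.2); last by rewrite big_seq1.
  by apply: balanced_relation_eq => //; rewrite -repE big_seq1.
move=> h [hD hE]; apply/funext => f.
have h0 : h 0 = 0 by apply: (@addrI _ (h 0)); rewrite -hD !addr0.
rewrite [in RHS](repE f) (big_morph _ hD h0).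
by apply: eq_bigr => x _; rewrite hE.
Qed.

End GaloisDescent.
(** * Generation of the symplectic group *)

Section Transvections.
Variables (F : topFieldType) (W : vectType F) (form : {skew_symmetric W}).
Hypothesis two0 : 2%:R != 0 :> F.
Hypothesis form_sympl : is_psymplectic form.

Lemma skewC u v : form u v = - form v u.
Proof. by rewrite hermC expr1 mulN1r. Qed.

Lemma skewDl u v w : form (u + v) w = form u w + form v w.
Proof. exact: linearDl. Qed.

Lemma skewBl u v w : form (u - v) w = form u w - form v w.
Proof. exact: linearBl. Qed.

Lemma skewDr u v w : form w (u + v) = form w u + form w v.
Proof. exact: linearDr. Qed.

Lemma skewZl a u v : form (a *: u) v = a * form u v.
Proof. exact: linearZl_LR. Qed.

Lemma skewZr a u v : form v (a *: u) = a * form v u.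
Proof. exact: linearZr_LR. Qed.

Lemma skew_self u : form u u = 0.
Proof.
apply/eqP; have : form u u *+ 2 == 0 by rewrite mulr2n {1}skewC addNr.
by rewrite -mulr_natl mulf_eq0 (negPf two0).
Qed.

Lemma form_nondegenerate u : u != 0 -> exists w, form u w != 0.
Proof.
have [/eqP nd _ _] := form_sympl.
rewrite -memv0 -nd => /mem_orthovPn[w _ uw].
by exists w.
Qed.

Definition transvection_fun (v : W) (a : F) (w : W) : W :=
  w + (a * form v w) *: v.

Fact transvection_linear v a : linear (transvection_fun v a).
Proof.
move=> c w w'; rewrite /transvection_fun skewDr skewZr.
by rewrite scalerDr addrACA mulrDr scalerDl scalerA; congr (_ + (_ *: _ + _)); ring.
Qed.
HB.instance Definition _ v a :=
  GRing.isLinear.Build F W W _ (transvection_fun v a) (transvection_linear v a).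

Definition transvection v a : 'End(W) := linfun (transvection_fun v a).

Lemma transvectionE v a w : transvection v a w = w + (a * form v w) *: v.
Proof. by rewrite lfunE. Qed.

Lemma transvection_Sp v a : Sp form (transvection v a).
Proof.
move=> w w'; rewrite !transvectionE.
rewrite skewDl !skewDr !skewZl !skewZr skew_self.
by rewrite (skewC w v); ring.
Qed.

Lemma Sp_comp g h : Sp form g -> Sp form h -> Sp form (g \o h)%VF.
Proof. by move=> gS hS u v; rewrite !comp_lfunE gS hS. Qed.

(** If u and v are not orthogonal, one transvection along v - u suffices. In general one passes
    through a vector w orthogonal to neither, which exists because a space is not the union of two
    hyperplanes. *)
Lemma Sp_transitive u v : u != 0 -> v != 0 -> exists2 g, Sp form g & g u = v.
Proof.
have one u' v' : form u' v' != 0 -> exists2 g, Sp form g & g u' = v'.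
  move=> uv; exists (transvection (v' - u') (form v' u')^-1).
    exact: transvection_Sp.
  rewrite transvectionE skewBl skew_self subr0 mulVf.
    by rewrite scale1r addrC subrK.
  by rewrite skewC oppr_eq0.
move=> /form_nondegenerate[w1 uw1] /form_nondegenerate[w2 vw2].
have [w uw vw] : exists2 w, form u w != 0 & form v w != 0.
  have [vw1|] := eqVneq (form v w1) 0; last by exists w1.
  have [uw2|] := eqVneq (form u w2) 0; last by exists w2.
  by exists (w1 + w2); rewrite skewDr ?uw2 ?vw1 ?addr0 ?add0r.
have [g gS gu] := one _ _ uw.
have [h hS hw] : exists2 g, Sp form g & g w = v.
  by apply: one; rewrite skewC oppr_eq0.
by exists (h \o g)%VF; [exact: Sp_comp|rewrite comp_lfunE gu].
Qed.

Section Generation.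
Variable P : 'End(W) -> Prop.
Hypothesis P1 : P \1%VF.
Hypothesis PM : forall g h, P g -> P h -> P (g \o h)%VF.
Hypothesis Pt : forall v a, P (transvection v a).

Let codim_fix (g : 'End(W)) := (\dim {:W} - \dim (fixedSpace g))%N.

Let transvectionK v a : (transvection v a \o transvection v (- a))%VF = \1%VF.
Proof.
apply/lfunP => w; rewrite comp_lfunE !transvectionE id_lfunE.
rewrite skewDr skewZr skew_self mulr0 addr0 mulNr scaleNr.
by rewrite addrNK.
Qed.

(* The fixed vectors of g are orthogonal to all g z - z. *)
Let fix_transvection g z a : Sp form g ->
  (fixedSpace g <= fixedSpace (transvection (g z - z) a \o g))%VS.
Proof.
move=> gS; apply/subvP => x /fixedSpaceP gx; apply/fixedSpaceP.
have zx : form (g z) x = form z x by rewrite -{1}gx gS.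
by rewrite comp_lfunE transvectionE gx skewBl zx subrr mulr0 scale0r addr0.
Qed.

Let codim_fixS g h : (fixedSpace g <= fixedSpace h)%VS ->
  (codim_fix h <= codim_fix g)%N.
Proof. by move=> gh; apply: leq_sub2l; exact: dimvS. Qed.

(** Induction on the codimension of the fixed space. If w and g w are not orthogonal, a transvection
    along g w - w brings g w back to w and keeps the vectors fixed by g, so the fixed space grows.
    If every x is orthogonal to g x, one auxiliary transvection first leads back to this
    situation. *)
Lemma Sp_generated_by_transvections g : Sp form g -> P g.
Proof.
have [m] := ubnP (codim_fix g); elim: m g => // m IH g gm gS.
have reduce h w : (codim_fix h <= codim_fix g)%N -> Sp form h ->
    form w (h w) != 0 -> P h.
  move=> hg hS whw; pose v := h w - w; pose a := (form v w)^-1.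
  have vw : form v w = form (h w) w by rewrite skewBl skew_self subr0.
  have vhw : form v (h w) = form v w.
    by rewrite vw skewBl skew_self sub0r -skewC.
  have vw0 : form v w != 0 by rewrite vw skewC oppr_eq0.
  have h'w : (transvection v (- a) \o h)%VF w = w.
    rewrite comp_lfunE transvectionE vhw mulNr /a mulVf// scaleN1r.
    by rewrite opprB addrC subrK.
  have -> : h = (transvection v a \o (transvection v (- a) \o h))%VF.
    by rewrite comp_lfunA transvectionK comp_lfun1l.
  apply: PM => //; apply: IH; last by apply: Sp_comp => //; exact: transvection_Sp.
  apply: leq_trans (leq_trans _ hg) gm.
  have fixS := fix_transvection w (- a) hS.
  have dimfix := dimvS (subvf (fixedSpace (transvection v (- a) \o h))).
  have lt_fix : (\dim (fixedSpace h) <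
      \dim (fixedSpace (transvection v (- a) \o h)%VF))%N.
    rewrite (ltn_leqif (dimv_leqif_sup fixS)); apply/negP => /subvP/(_ w) hw.
    have /fixedSpaceP hw' : w \in fixedSpace h by apply: hw; apply/fixedSpaceP.
    by move: whw; rewrite hw' skew_self eqxx.
  by apply: ltn_sub2l => //; apply: leq_trans dimfix.
have [[w]|hyp] := pselect (exists w, form w (g w) != 0).
  exact: reduce.
have [->//|g1] := eqVneq g \1%VF.
have [w gw] : exists w, g w - w != 0.
  apply: contrapT => ng; move/eqP: g1; apply; apply/lfunP => w.
  rewrite id_lfunE; apply/eqP; rewrite -subr_eq0.
  by apply: contrapT => /negP gw; apply: ng; exists w.
have {}hyp x : form x (g x) = 0.
  by apply: contrapT => /eqP gx; apply: hyp; exists x.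
(* Polarisation of [hyp]. With [u] below, it makes [form u w] and [form u (g w)] both equal, up to
   sign, to the nonzero number [form (g w - w) z], so that [w] is not orthogonal to its image under
   the modified map. *)
have hypC x y : form x (g y) = form (g x) y.
  have := hyp (x + y).
  rewrite linearD skewDl !skewDr !hyp addr0 add0r => /eqP.
  by rewrite addr_eq0 => /eqP ->; rewrite -skewC.
have [z zw] := form_nondegenerate gw.
pose u := g z - z.
have uw : form u w = - form (g w - w) z.
  by rewrite /u !skewBl -hypC [form z _]skewC [form z w]skewC; ring.
have ugw : form u (g w) = form (g w - w) z.
  by rewrite /u !skewBl gS [form z _]skewC [form z w]skewC; ring.
have -> : g = (transvection u (- 1) \o (transvection u 1 \o g))%VF.
  by rewrite comp_lfunA -{2}[1]opprK transvectionK comp_lfun1l.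
apply: PM => //; apply: (@reduce _ w).
- by apply: codim_fixS; exact: fix_transvection.
- by apply: Sp_comp => //; exact: transvection_Sp.
rewrite comp_lfunE transvectionE skewDr hyp add0r mul1r skewZr.
by rewrite mulf_neq0// ?ugw// skewC uw opprK.
Qed.

End Generation.
End Transvections.

(** * Generators of the metaplectic group *)

Section MetaplecticGeneration.
Variables (F : topFieldType) (W : vectType F) (form : {skew_symmetric W}).
Variables (X : {vspace W}) (Mp : topGroupType).
Variables (pr : Mp -> 'End(W)) (eps : Mp) (s : 'End(W) -> Mp).
Hypothesis two0 : 2%:R != 0 :> F.
Hypothesis W_nonzero : (0 < \dim {:W})%N.
Hypothesis form_sympl : is_psymplectic form.
Hypothesis X_lagrangian : lagrangian form X.
Hypothesis Mp_meta : metaplectic form X pr eps s.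

Lemma transvection_NX x a : x \in X -> NX form X (transvection form x a).
Proof.
move=> xX; split=> [|x' x'X|w]; first exact: transvection_Sp.
  move: xX; rewrite -(eqP X_lagrangian) => /mem_orthovP/(_ _ x'X) xx'.
  by rewrite transvectionE xx' mulr0 scale0r addr0.
by rewrite transvectionE addrC addKr memvZ.
Qed.

Lemma lagrangian_nonzero : exists2 x, x \in X & x != 0.
Proof.
exists (vpick X); first exact: memv_pick.
rewrite vpick0; apply/eqP => X0; move: W_nonzero.
by rewrite -(orthov0 form) -X0 (eqP X_lagrangian) X0 dimv0.
Qed.

Lemma pr1 : pr 1%g = \1%VF.
Proof. by apply/(mp_ker Mp_meta); left. Qed.

Lemma pr_Sp a : Sp form (pr a).
Proof. by rewrite -(mp_range Mp_meta); exists a. Qed.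

Lemma pr_inj a b : pr a = pr b -> a = b \/ a = (eps * b)%g.
Proof.
move=> ab; have /(mp_ker Mp_meta) : pr (a * b^-1)%g = \1%VF.
  by rewrite (mp_prM Mp_meta) ab -(mp_prM Mp_meta) mulgV pr1.
case=> h; [left|right]; apply: (@mulIg _ b^-1%g).
  by rewrite h mulgV.
by rewrite h mulgK.
Qed.

(** Every transvection is conjugate in Sp(W) to one along a vector of X, which lies in N(X), and
    transvections generate Sp(W). Two lifts of the same element differ at most by [eps], so a
    property stable under products and true at [eps] passes from one lift to the other. *)
Lemma metaplectic_ind (M : Mp -> Prop) :
  M eps -> (forall a b, M a -> M b -> M (a * b)%g) ->
  (forall a b, M b -> M (a * b * a^-1)%g) ->
  (forall n, NX form X n -> M (s n)) -> forall a, M a.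
Proof.
move=> Meps MM MJ Mn.
pose P g := Sp form g /\ forall a, pr a = g -> M a.
have lift g b : pr b = g -> M b -> forall a, pr a = g -> M a.
  by move=> <- Mb a /pr_inj[->//|->]; exact: MM.
have lift1 g : g = \1%VF -> forall a, pr a = g -> M a.
  move=> ->; have NX1 : NX form X \1%VF.
    by split=> [u v|x _|w]; rewrite !id_lfunE// subrr mem0v.
  move=> a; apply: (lift _ (s \1%VF)); last exact: Mn.
  by case: NX1 => S1 _ _; exact: (mp_section Mp_meta).
have PM g h : P g -> P h -> P (g \o h)%VF.
  move=> [gS Mg] [hS Mh]; split=> [|a]; first exact: Sp_comp.
  apply: (lift _ (s g * s h)%g).
    by rewrite (mp_prM Mp_meta) !(mp_section Mp_meta).
  apply: MM; first by apply: Mg; rewrite (mp_section Mp_meta).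
  by apply: Mh; rewrite (mp_section Mp_meta).
have [x xX x0] := lagrangian_nonzero.
have Pt v c : P (transvection form v c).
  split=> [|a]; first exact: transvection_Sp.
  have [->|v0] := eqVneq v 0.
    apply: lift1 a; apply/lfunP => w.
    by rewrite id_lfunE transvectionE scaler0 addr0.
  have [g gS gx] := Sp_transitive two0 form_sympl x0 v0.
  have tS := transvection_Sp form two0 x c.
  apply: (lift _ (s g * s (transvection form x c) * (s g)^-1)%g); last first.
    by apply: MJ; apply: Mn; exact: transvection_NX.
  apply/lfunP => w.
  have wE : w = g (pr (s g)^-1%g w).
    rewrite -{1}(mp_section Mp_meta gS) -comp_lfunE -(mp_prM Mp_meta) mulgV.
    by rewrite pr1 id_lfunE.
  rewrite (mp_prM Mp_meta) (mp_prM Mp_meta) !comp_lfunE !(mp_section Mp_meta)//.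
  rewrite [in RHS]wE; move: (pr _ _) => w'.
  by rewrite !transvectionE linearD linearZ /= -gx gS.
have P1 : P \1%VF by split; [rewrite -pr1; exact: pr_Sp|exact: lift1].
move=> a.
by have [_] := Sp_generated_by_transvections two0 form_sympl P1 PM Pt (pr_Sp a); apply.
Qed.

End MetaplecticGeneration.
(** * Schwartz functions and Schur's lemma *)

Lemma locally_constant_open (T : topologicalType) (A : Type) (f : T -> A)
    (P : set A) : locally_constant f -> open (f @^-1` P).
Proof.
move=> flc; rewrite openE => x Pfx; rewrite /interior.
by apply: filterS (flc x) => y; rewrite /preimage/= => ->.
Qed.

Lemma vtop_finite_subcover (F : topFieldType) (V : vectType F)
    (A : set (vtop V)) (I : choiceType) (D : set I) (f : I -> set (vtop V)) :
  compact A -> (forall i, D i -> open (f i)) ->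
  (forall x, A x -> exists2 i, D i & f i x) ->
  exists2 s : seq I, (forall i, i \in s -> D i) &
    forall x, A x -> exists2 i, i \in s & f i x.
Proof.
pose T : ptopologicalType := HB.pack (vtop V) (isPointed.Build (vtop V) (0 : V)).
move=> Ac fo fA; have : cover_compact A.
  by rewrite -[cover_compact A]/(@cover_compact T A) -compact_cover.
move=> /(_ I D f fo fA)[s sD sA]; exists (finmap.enum_fset s).
  by move=> i /sD; rewrite inE.
by move=> x /sA[i si fi]; exists i.
Qed.

Section SchwartzFunctions.
Variables (F : topFieldType) (V : vectType F) (K : fieldType).
Implicit Types f g : schwartz V K.

Lemma schwartz_lc f : locally_constant (f : vtop V -> K).
Proof. by have /asboolP[] := valP f. Qed.

Definition schwartz_support f : set (vtop V) := 
  closure ([set x | f x != 0] : set (vtop V)).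

Lemma schwartz_support_compact f : compact (schwartz_support f).
Proof. by have /asboolP[] := valP f. Qed.

Lemma schwartz_supportN f x : ~ schwartz_support f x -> f x = 0.
Proof.
by move=> nx; apply/eqP; apply: contra_notT nx => fx; exact: subset_closure.
Qed.

(** The nonvanishing locus of a locally constant function is already closed. *)
Lemma schwartz_support_neq0 f x : schwartz_support f x -> f x != 0.
Proof. by move=> /(_ _ (schwartz_lc f x))[y [/= fy <-]]. Qed.

Lemma schwartz_eqP f g : (forall x, f x = g x) -> f = g.
Proof. by move=> fg; apply/val_inj/funext. Qed.

Lemma schwartzD f g x : (f + g) x = f x + g x. Proof. by []. Qed.
Lemma schwartzZ c f x : (c *: f) x = c * f x. Proof. by []. Qed.

Fact schwartz_mul_subproof (m : V -> K) f :
  locally_constant (m : vtop V -> K) ->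
  schwartz_pred (fun x => m x * f x : K^o).
Proof.
move=> mlc; apply/asboolP; split.
  exact: (locally_constant2 (fun x y : K => x * y) mlc (schwartz_lc f)).
apply: (@compact_closureS (vtop V) _ [set x | f x != 0]); last first.
  exact: schwartz_support_compact.
by move=> x /=; apply: contra_neq => ->; rewrite mulr0.
Qed.

Definition schwartz_mul m (mlc : locally_constant (m : vtop V -> K)) f :=
  Schwartz (schwartz_mul_subproof f mlc).

End SchwartzFunctions.

Section Schur.
Variables (F : topFieldType) (W : vectType F) (form : {skew_symmetric W}).
Variables (X Y : {vspace W}) (K : fieldType) (psi : smooth_character F K).
Hypothesis XY_pol : complete_polarisation form X Y.
Hypothesis psi_nontrivial : exists x, psi x != 1.
Local Notation S := (schwartz (subvs_of Y) K).
Implicit Types f g : S.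
Local Notation rho := (@heisenberg_rep F W form X Y K psi).

Lemma polarisationE w : w = xpart X Y w + vsval (ypart X Y w).
Proof.
have [_ _ dXY sXY] := XY_pol.
rewrite /xpart /ypart vsprojK ?memv_pi //.
by rewrite daddv_pi_add // sXY memvf.
Qed.

Lemma xpart_id x : x \in X -> xpart X Y x = x.
Proof. by have [_ _ dXY _] := XY_pol; exact: daddv_pi_id. Qed.

Lemma ypart_X x : x \in X -> ypart X Y x = 0.
Proof.
move=> xX; apply: subvs_inj; apply: (@addrI _ (xpart X Y x)).
by rewrite -polarisationE [in RHS]xpart_id// addr0.
Qed.

Lemma ypart_id (y : subvs_of Y) : ypart X Y (vsval y) = y.
Proof.
have [_ _ dXY _] := XY_pol.
by rewrite /ypart daddv_pi_id ?vsvalK ?subvsP// capvC.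
Qed.

Lemma xpart_Y (y : subvs_of Y) : xpart X Y (vsval y) = 0.
Proof.
apply: (@addIr _ (vsval y)).
by rewrite -{2}(ypart_id y) -polarisationE add0r.
Qed.

Lemma heisenberg_X x f y : x \in X ->
  rho (x, 0) f y = psi (form (vsval y) x) * f y.
Proof.
move=> xX; rewrite /= /heisenberg_fun/= xpart_id// ypart_X// addr0 schar0 mul1r.
by rewrite linear0l mulr0 addr0.
Qed.

Lemma heisenberg_Y (y' : subvs_of Y) f y : rho (vsval y', 0) f y = f (y + y').
Proof.
rewrite /= /heisenberg_fun/= xpart_Y ypart_id schar0 mul1r.
by rewrite !linear0r mulr0 addr0 schar0 mul1r.
Qed.

Lemma pairing_lc x :
  locally_constant (fun y : vtop (subvs_of Y) => psi (form (vsval y) x)).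
Proof.
apply: (@locally_constant_comp (vtop (subvs_of Y)) F); last exact: schar_lc.
pose u (y : subvs_of Y) : F^o := form (vsval y) x.
have ulin : linear u by move=> a v w; rewrite /u linearP linearPl.
pose ul : {linear subvs_of Y -> F^o} :=
  HB.pack u (GRing.isLinear.Build F (subvs_of Y) F^o _ u ulin).
exact: (@linear_vtop_continuous F (subvs_of Y) ul).
Qed.

(** As X is its own orthogonal and meets Y trivially, some x in X pairs non-trivially with y;
    rescaling x gives the pairing any value of F. *)
Lemma pairing_separates (y : subvs_of Y) : y != 0 ->
  exists2 x, x \in X & psi (form (vsval y) x) != 1.
Proof.
have [/eqP lX _ dXY _] := XY_pol; have [t psit] := psi_nontrivial.
move=> y0; have /mem_orthovPn[x xX yx] : vsval y \notin orthov form X.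
  rewrite lX; apply: contra y0 => yX.
  by rewrite -(inj_eq subvs_inj) /= -memv0 -dXY memv_cap yX subvsP.
exists ((t / form (vsval y) x) *: x); first exact: memvZ.
by rewrite linearZr_LR /= divfK.
Qed.

(** Elements of X act by multiplication by characters of Y, elements of Y by translation. Commuting
    with the former makes [A f 0] depend only on [f 0]: a function vanishing at 0 is a finite sum of
    terms [rho (x, 0) h - h], whose images under [A] vanish at 0. Translations then carry the
    resulting scalar to every point. *)
Lemma schur (A : S -> S) : {morph A : f g / f + g} ->
  (forall c f, A (c *: f) = c *: A f) ->
  (forall h f, A (rho h f) = rho h (A f)) ->
  exists c, forall f, A f = c *: f.
Proof.
move=> AD AZ Arho.
have A0 : A 0 = 0 by apply: (@addrI _ (A 0)); rewrite -AD !addr0.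
pose sep xs (y : subvs_of Y) := has (fun x => psi (form (vsval y) x) != 1) xs.
have vanish_cover (xs : seq W) f : {in xs, forall x, x \in X} ->
    (forall y, f y != 0 -> sep xs y) -> A f 0 = 0.
  elim: xs f => [|x xs IH] f xsX fxs.
    suff -> : f = 0 by rewrite A0.
    apply: schwartz_eqP => y; apply/eqP; apply/negPn/negP => /fxs.
    by rewrite /sep.
  have mlc : locally_constant (fun y : vtop (subvs_of Y) =>
      (psi (form (vsval y) x) - 1)^-1).
    by move=> y; apply: filterS (pairing_lc x y) => z ->.
  (* Where the character of [x] differs from 1, [g] vanishes. Elsewhere the inverse of 0 is 0, so
     [h] vanishes and [g] agrees with [f]; there the remaining [xs] separate. *)
  pose h := schwartz_mul mlc f; pose g := f - (rho (x, 0) h - h).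
  have xX : x \in X by apply: xsX; rewrite mem_head.
  have g0 : A g 0 = 0.
    apply: IH => [z zxs|y gy]; first by apply: xsX; rewrite inE zxs orbT.
    have gyE : g y = f y - (psi (form (vsval y) x) * h y - h y).
      by rewrite -heisenberg_X.
    have hyE : h y = (psi (form (vsval y) x) - 1)^-1 * f y by [].
    have [p1|p1] := eqVneq (psi (form (vsval y) x)) 1.
      have fy : f y != 0.
        by apply: contraNneq gy => fy; rewrite gyE hyE fy !mulr0 !subr0.
      by have := fxs y fy; rewrite /sep/= p1 eqxx.
    have hy : psi (form (vsval y) x) * h y - h y = f y.
      by rewrite -[X in _ - X]mul1r -mulrBl hyE mulrA mulfV ?mul1r ?subr_eq0.
    by move: gy; rewrite gyE hy subrr eqxx.
  have -> : f = g + (rho (x, 0) h + (-1) *: h).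
    by rewrite scaleN1r /g subrK.
  rewrite (AD g) (AD (rho (x, 0) h)) AZ Arho schwartzD g0 add0r.
  rewrite schwartzD schwartzZ heisenberg_X//.
  by rewrite linear0l schar0 mul1r mulN1r subrr.
have vanish f : f 0 = 0 -> A f 0 = 0.
  move=> f0.
  pose D x : set (vtop (subvs_of Y)) :=
    [set y | psi (form (vsval (y : subvs_of Y)) x) != 1].
  have := vtop_finite_subcover (@schwartz_support_compact _ _ _ f)
    (D := [set` X]) (f := D).
  case=> [x _|y fy|xs xsX cov].
  - exact: (locally_constant_open [set z | z != 1] (pairing_lc x)).
  - have y0 : y != 0.
      by apply: contraTneq (schwartz_support_neq0 fy) => ->; rewrite f0 eqxx.
    by have [x xX px] := pairing_separates y0; exists x.
  apply: (vanish_cover xs) => [x /xsX//|y fy].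
  have [x xxs px] := cov y (@subset_closure (vtop (subvs_of Y)) [set x | f x != 0] y fy).
  by apply/hasP; exists x.
(* If all functions vanish at 0, then by translation they vanish everywhere, and the scalar 0
   serves. *)
have [[f1 f1nz]|nf] := pselect (exists f1 : S, f1 0 != 0); last first.
  exists 0 => f; apply: schwartz_eqP => y; apply/eqP; apply: contrapT => /negP Ay.
  apply: nf; exists (rho (vsval y, 0) (A f)).
  by rewrite heisenberg_Y add0r scale0r in Ay *.
pose c : K := A f1 0 / f1 0; exists c => f; apply: schwartz_eqP => y.
pose d : K := f y / f1 0.
have : A (rho (vsval y, 0) f + (- d) *: f1) 0 = 0.
  apply: vanish; rewrite schwartzD schwartzZ heisenberg_Y add0r.
  by rewrite mulNr divfK// subrr.
rewrite AD AZ schwartzD schwartzZ Arho heisenberg_Y add0r => /eqP.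
rewrite mulNr subr_eq0 => /eqP ->.
by rewrite schwartzZ /d /c [RHS]mulrAC -[RHS]mulrA mulrC.
Qed.

End Schur.

(** * Dilations and semilinear twists of Schwartz functions *)

Section Dilations.
Variables (F : topFieldType) (V : vectType F) (K : fieldType).

Lemma scale_vtop_continuous :
  continuous ((fun z => z.1 *: (z.2 : V)) : F * vtop V -> vtop V).
Proof.
apply: vtop_continuous => i.
under eq_fun do rewrite linearZ.
apply: (@continuousMf F (F * vtop V)%type fst).
  by move=> z; exact: cvg_fst.
move=> z; apply: (@continuous_comp _ _ _ snd (fun v : vtop V => coord (vbasis {:V}) i v)).
  exact: cvg_snd.
exact: coord_continuous.
Qed.

Lemma scalel_vtop_continuous (b : F) :
  continuous ((fun y => b *: (y : V)) : vtop V -> vtop V).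
Proof.
apply: vtop_continuous => i; under eq_fun do rewrite linearZ.
by apply: continuousMf; [exact: cst_continuous|exact: coord_continuous].
Qed.

Section Twist.
Variables (g : K -> K) (g0 : g 0 = 0) (b : F) (b0 : b != 0).

Fact schwartz_twist_subproof (f : schwartz V K) :
  schwartz_pred (fun y => g (f (b^-1 *: y)) : K^o).
Proof.
apply/asboolP; split.
  have flc := locally_constant_comp (@scalel_vtop_continuous b^-1) (@schwartz_lc _ _ _ f).
  by move=> y; apply: filterS (flc y) => z /= ->.
pose B : set (vtop V) := (fun y : vtop V => b *: (y : V) : vtop V) @` schwartz_support f.
have Bc : compact B.
  apply: continuous_compact; last exact: schwartz_support_compact.
  by apply: continuous_subspaceT; exact: scalel_vtop_continuous.
apply: (@subclosed_compact _ _ B) => //; first exact: closed_closure.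
move=> z cz; exists (b^-1 *: (z : V)); last by rewrite scalerA mulfV// scale1r.
move=> U nU; have [w [fw Uw]] := cz _ (scalel_vtop_continuous nU).
exists (b^-1 *: (w : V)); split=> //=.
by apply: contra_neq fw => /= ->.
Qed.

Definition schwartz_twist (f : schwartz V K) : schwartz V K :=
  Schwartz (schwartz_twist_subproof f).

End Twist.

(** Compactness gives the equality on the support for b near 1. A point y outside the support might
    be moved into it by b; the same equality for the inverse of b, applied at b y, excludes this. *)
Lemma schwartz_dilation_near (f : schwartz V K) :
  \forall b \near (1 : F), b != 0 -> forall y, f (b *: y) = f y.
Proof.
have near_supp : \forall b \near (1 : F),
    schwartz_support f `<=` [set y | f (b *: y) = f y].
  have /compact_near_coveringP cov := @schwartz_support_compact _ _ _ f.
  apply: cov => y _.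
  have /= fy := @schwartz_lc _ _ _ f y.
  have : nbhs ((1 : F) *: y : vtop V) [set z | f z = f y] by rewrite scale1r.
  move=> /(@scale_vtop_continuous (1, y : vtop V)) [[P Q] /= [P1 Qy] PQ].
  exists (Q `&` [set z | f z = f y], P) => /=; first by split => //; exact: filterI.
  by move=> [z b] /= [[Qz fz] Pb]; rewrite fz; exact: (PQ (b, z)).
have inv1 : {for (1 : F), continuous (@GRing.inv F)}.
  by apply: inv_continuous; exact: oner_neq0.
have near_inv : \forall b \near (1 : F),
    schwartz_support f `<=` [set y | f (b^-1 *: y) = f y].
  have : \forall b \near (1 : F)^-1,
      schwartz_support f `<=` [set y | f (b *: y) = f y] by rewrite invr1.
  by move=> /inv1.
near=> b => b0.
have fb : schwartz_support f `<=` [set y | f (b *: y) = f y] by near: b.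
have fbV : schwartz_support f `<=` [set y | f (b^-1 *: y) = f y] by near: b.
move=> y; have [/fb//|/schwartz_supportN fy] := pselect (schwartz_support f y).
have [/fbV|/schwartz_supportN ->//] := pselect (schwartz_support f (b *: y)).
by rewrite /= scalerA mulVf// scale1r.
Unshelve. all: by end_near. Qed.

End Dilations.
(** Thus an automorphism of K that fixes finitely many elements fixes all values of f. *)
Lemma schwartz_finite_values (F : topFieldType) (V : vectType F) (K : fieldType)
    (f : schwartz V K) : exists s : seq K, forall y, f y != 0 -> (f y : K) \in s.
Proof.
pose B (c : K) : set (vtop V) := [set y | (f y : K) = c].
have [c _|y _|s _ sP] := vtop_finite_subcover (@schwartz_support_compact _ _ _ f)
  (D := [set: K]) (f := B).
- exact: (locally_constant_open [set c] (@schwartz_lc _ _ _ f)).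
- by exists (f y).
exists s => y fy.
have [c cs /= ->//] := sP y (@subset_closure (vtop V) [set x | f x != 0] y fy).
Qed.

(** * The Galois group *)

(** Without a fixed point, [u] would exchange the indices with i < u i and those with i > u i, and n
    would be even. *)
Lemma involution_fixpoint n (u : 'I_n -> 'I_n) :
  odd n -> involutive u -> exists i, u i = i.
Proof.
move=> nodd uK; apply: contrapT => nfix.
pose A := [set i : 'I_n | (i < u i)%N]%SET.
have uA : (u @: A = ~: A)%SET.
  apply/setP => i; rewrite !inE -{1}[i]uK (mem_imset _ _ (inv_inj uK)) inE uK.
  rewrite -leqNgt [RHS]leq_eqVlt; case: eqP => // /ord_inj ui.
  by case: nfix; exists i.
move: nodd; rewrite -[n]card_ord -(cardsC A) -uA card_imset; last exact: inv_inj.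
by rewrite addnn odd_double.
Qed.

Section GaloisGroup.
Variables (R0 K : fieldType) (iota : {rmorphism R0 -> K}).
Local Notation G := (galois_group iota).

Lemma galois_rmorphism g : G g -> exists h : {rmorphism K -> K}, g = h.
Proof.
move=> [_ gB gM _].
pose h : {rmorphism K -> K} := HB.pack g (GRing.isZmodMorphism.Build K K g gB)
  (GRing.isMonoidMorphism.Build K K g gM).
by exists h.
Qed.

Lemma galois_horner g (P : {poly R0}) z : G g ->
  g (map_poly iota P).[z] = (map_poly iota P).[g z].
Proof.
move=> Gg; have [h gh] := galois_rmorphism Gg; have [_ _ _ gi] := Gg.
rewrite gh -horner_map -map_poly_comp; congr (_.[_]).
by apply: eq_map_poly => a; rewrite /= -gh gi.
Qed.

Lemma galois_root_of_unity g N (z : K) : G g -> N.-primitive_root z ->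
  exists e, forall x : K, x ^+ N = 1 -> g x = x ^+ e.
Proof.
move=> Gg zN; have [h gh] := galois_rmorphism Gg.
have /(prim_rootP zN)[e ze] : (g z) ^+ N = 1.
  by rewrite gh -rmorphXn (prim_expr_order zN) rmorph1.
exists e => x /(prim_rootP zN)[i ->].
by rewrite {1}gh rmorphXn -gh ze -!exprM mulnC.
Qed.

Variables (p : nat) (A : set nat).
Hypothesis K_cyclo : cyclotomic_extension iota p A.

Lemma galois_abelian g h x : G g -> G h -> g (h x) = h (g x).
Proof.
move=> Gg Gh; have [k [z [P [_ zk ->]]]] := K_cyclo.2 x.
rewrite !(galois_horner, zk)//; congr (_.[_]).
have [a ga] := galois_root_of_unity Gg zk.
have [b hb] := galois_root_of_unity Gh zk.
have z1 := prim_expr_order zk.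
have zX i : (z ^+ i) ^+ (p ^ k)%N = 1 by rewrite exprAC z1 expr1n.
by rewrite (hb z)// (ga z)// ga// hb// exprAC.
Qed.

Lemma fixed_root_of_unity g N (z x : K) : G g -> N.-primitive_root z -> g z = z ->
  x ^+ N = 1 -> g x = x.
Proof.
move=> Gg zN gz /(prim_rootP zN)[i ->].
by have [h gh] := galois_rmorphism Gg; rewrite gh rmorphXn -gh gz.
Qed.

(** The groups of roots of unity of order p^k are nested, so the root of largest order controls all
    of [xs]. Stabilisers of single roots of unity thus form a basis of neighbourhoods of the
    identity. *)
Lemma stabiliser_of_seq (xs : seq K) : exists k (z : K), (p ^ k)%N.-primitive_root z /\
  forall g, G g -> g z = z -> {in xs, g =1 id}.
Proof.
elim: xs => [|x xs [k [z [zk IH]]]].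
  exists 0, 1; split=> //; apply/andP; split=> //; apply/forallP => i.
  by rewrite ord1 unity_rootE expr1n eqxx.
have [k' [z' [P [_ zk' ->]]]] := K_cyclo.2 x.
have le_root i i' (w w' : K) : (p ^ i)%N.-primitive_root w ->
    (p ^ i')%N.-primitive_root w' -> (i <= i')%N -> w ^+ (p ^ i')%N = 1.
  by move=> wi _ ii'; rewrite -(subnKC ii') expnD exprM (prim_expr_order wi) expr1n.
have [kk'|k'k] := leqP k k'; [exists k', z'|exists k, z]; split=> // g Gg gz.
  have gz' := fixed_root_of_unity Gg zk' gz (le_root _ _ _ _ zk zk' kk').
  move=> y; rewrite inE => /predU1P[->|]; last exact: (IH g Gg gz').
  by rewrite galois_horner// gz.
have gz' := fixed_root_of_unity Gg zk gz (le_root _ _ _ _ zk' zk (ltnW k'k)).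
move=> y; rewrite inE => /predU1P[->|]; last exact: (IH g Gg gz).
by rewrite galois_horner// gz'.
Qed.

Section OddPart.
Variable H : set (K -> K).
Hypothesis H_sub : closed_subgroup iota H.
Hypothesis H_odd : pro_order_prime_to 2 H.

Let HG g : H g -> G g. Proof. by have [_ h _] := H_sub; exact: h. Qed.

(* The cosets of the stabiliser of x are in odd number, so that one of them
   is fixed by g. *)
Lemma odd_fix_square g x : H g -> g (g x) = x -> g x = x.
Proof.
move=> Hg ggx; have [[H1 HM HV] _ _] := H_sub.
pose U := [set h | H h /\ h x = x].
have Hinj h : H h -> injective h by move=> /HG[/bij_inj].
have Uopen : open_subgroup H U.
  split; last first.
  - by exists [:: x] => h Hh hx; split=> //; apply: hx; rewrite mem_head.
  - by move=> h [].
  split=> [|h k [Hh hx] [Hk kx]|h [Hh hx]]; first by split.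
    by split; [exact: HM|rewrite /= kx hx].
  have [k [Hk hk kh]] := HV h Hh; exists k; split=> //; split=> //.
  by rewrite -{1}hx hk.
pose T (C : set (K -> K)) := [set g \o k | k in C].
have TC C : left_cosets H U C -> left_cosets H U (T C).
  move=> [h Hh <-]; exists (g \o h); first exact: HM.
  by rewrite /T image_comp.
have TK C : left_cosets H U C -> T (T C) = C.
  move=> [h Hh <-]; apply/seteqP.
  split=> [_ [_ [_ [v [Hv vx] <-] <-] <-]|_ [v [Hv vx] <-]].
    exists (g \o (g \o v)); last first.
      by apply/funext => y /=; rewrite !(galois_abelian _ (HG Hg) (HG Hh)).
    by split; [exact: (HM g (g \o v) Hg (HM g v Hg Hv))|rewrite /= vx].
  have [k [Hk gk kg]] := HV g Hg.
  exists (g \o (h \o (k \o (k \o v)))).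
    exists (h \o (k \o (k \o v))) => //; exists (k \o (k \o v)) => //.
    by split; [exact: (HM k (k \o v) Hk (HM k v Hk Hv))|rewrite /= vx -{1}ggx !gk].
  apply/funext => y /=.
  by rewrite !(galois_abelian _ (HG Hg) (HG Hh)) !kg.
have [n n2 /card_set_bijP[c [cn c_inj c_surj]]] := H_odd Uopen.
have /choice[r rE] (i : 'I_n) : exists C, left_cosets H U C /\ c C = i.
  by have [C HC Ci] := c_surj i (ltn_ord i); exists C.
have rI : injective r by move=> i k ik; apply/ord_inj; rewrite -(rE i).2 ik (rE k).2.
have /choice[u uE] (i : 'I_n) : exists k, r k = T (r i).
  have Tri := TC _ (rE i).1; have := cn _ Tri; rewrite /= => lt_n.
  exists (Ordinal lt_n); apply: c_inj; rewrite ?inE//; first exact: (rE _).1.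
  by rewrite (rE _).2.
have [||i] := @involution_fixpoint n u.
- by rewrite -coprimen2.
- by move=> i; apply: rI; rewrite !uE TK//; exact: (rE i).1.
have := (rE i).1 => -[h Hh rh] ui.
have : r i (g \o h).
  rewrite -ui uE -rh; by exists h => //; exists id => //.
rewrite -rh => -[v [_ vx] /(congr1 (fun k => k x)) /=].
by rewrite vx (galois_abelian _ (HG Hg) (HG Hh)) => /(Hinj h Hh).
Qed.

Section FixedVectors.
Variables (S : lmodType K) (R : (K -> K) -> S -> S).
Hypothesis RD : forall g, H g -> {morph R g : v w / v + w}.
Hypothesis RZ : forall g c v, H g -> R g (c *: v) = g (g c) *: R g v.
Hypothesis RM : forall g h v, H g -> H h -> R (g \o h) v = R g (R h v).

(* Lagrange interpolation at the conjugates w of z: the fixed vectors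
   v_i = \sum_w w ^ i *: R_w f recover f = R_z f. *)
Lemma span_fixed_vectors f N z : N.-primitive_root z ->
  (forall g, H g -> g z = z -> R g f = f) ->
  exists n (v : nat -> S) (c : nat -> K),
    (forall i g, H g -> R g (v i) = v i) /\ f = \sum_(i < n) c i *: v i.
Proof.
move=> zN f_fix; have [[H1 HM HV] _ _] := H_sub.
have rm g : H g -> exists h : {rmorphism K -> K}, g = h.
  by move=> /HG/galois_rmorphism.
pose conj w := exists2 g, H g & g (g z) = w.
pose nodes := [seq w <- undup [seq z ^+ i | i <- index_iota 0 N] | `[< conj w >]].
have nodesP w : reflect (conj w) (w \in nodes).
  apply: (iffP idP) => [|cw]; first by rewrite mem_filter => /andP[/asboolP].
  rewrite mem_filter; apply/andP; split; first exact/asboolP.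
  have [g Hg <-] := cw; have [h gh] := rm g Hg.
  have /(prim_rootP zN)[i ->] : (g (g z)) ^+ N = 1.
    by rewrite gh -!rmorphXn (prim_expr_order zN) !rmorph1.
  by rewrite mem_undup; apply/mapP; exists (i : nat); rewrite ?mem_index_iota/=.
have /choice[r rE] w : exists g, conj w -> H g /\ g (g z) = w.
  have [[g Hg gw]|nw] := pselect (conj w); first by exists g.
  by exists id.
have rH w : w \in nodes -> H (r w) by move=> /nodesP/rE[].
have rw w : w \in nodes -> r w (r w z) = w by move=> /nodesP/rE[].
have zn : z \in nodes by apply/nodesP; exists id.
(* If g^2 z = h^2 z, the square of k g, with k inverse to h, fixes z. By the odd order k g itself
   fixes z, hence fixes f. *)
have R_eq g h : H g -> H h -> g (g z) = h (h z) -> R g f = R h f.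
  move=> Hg Hh gh; have [k [Hk hk kh]] := HV h Hh.
  have comm x := galois_abelian x (HG Hk) (HG Hg).
  have Hkg := HM k g Hk Hg.
  have kgz : (k \o g) z = z.
    by apply: odd_fix_square => //=; rewrite -comm gh !hk.
  rewrite -[in RHS](f_fix _ Hkg kgz) -RM//; congr (R _ f).
  by apply/funext => x /=; rewrite kh.
have R_sum g s (P : K -> S) : H g -> R g (\sum_(w <- s) P w) = \sum_(w <- s) R g (P w).
  move=> Hg; apply: (big_morph _ (RD Hg)).
  have [h gh] := rm g Hg.
  by have := RZ 0 0 Hg; rewrite scaler0 gh !rmorph0 scale0r.
pose v i := \sum_(w <- nodes) w ^+ i *: R (r w) f.
pose q := \prod_(w <- rem z nodes) ('X - w%:P).
have nodes_uniq : uniq nodes by rewrite filter_uniq// undup_uniq.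
have qz : q.[z] != 0.
  rewrite /q -/(root _ _) root_prod_XsubC mem_rem_uniqF//.
exists (size q), v, (fun i => q`_i / q.[z]); split=> [i g Hg|].
  rewrite /v R_sum//; have [h gh] := rm g Hg.
  have nodes_perm : perm_eq nodes [seq g (g w) | w <- nodes].
    have gn_uniq : uniq [seq g (g w) | w <- nodes].
      by rewrite map_inj_uniq// => x y; rewrite gh => /fmorph_inj/fmorph_inj.
    have gn_sub : {subset [seq g (g w) | w <- nodes] <= nodes}.
      move=> _ /mapP[w /nodesP[k Hk <-] ->]; apply/nodesP.
      exists (g \o k); first exact: HM.
      by rewrite /= -(galois_abelian _ (HG Hg) (HG Hk)).
    rewrite perm_sym; apply: uniq_perm => //.
    by have [|_] := uniq_min_size gn_uniq gn_sub; rewrite ?size_map.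
  rewrite [RHS](perm_big _ nodes_perm) big_map/= !big_seq; apply: eq_bigr => w wn.
  rewrite RZ// {1 2}gh !rmorphXn -gh; congr (_ *: _).
  have gwn : g (g w) \in nodes by rewrite (perm_mem nodes_perm) map_f.
  rewrite -RM//; last exact: rH.
  apply: R_eq; [by apply: HM => //; exact: rH|exact: rH|].
  by rewrite rw//= -(galois_abelian _ (HG Hg) (HG (rH _ wn))) rw.
transitivity (q.[z]^-1 *: \sum_(w <- nodes) q.[w] *: R (r w) f).
  rewrite (big_rem z zn)/= big1_seq ?addr0 ?scalerA ?mulVf// => [|w wn].
    by rewrite scale1r (R_eq _ id) ?f_fix// ?rw//; exact: rH.
  by rewrite (_ : q.[w] = 0) ?scale0r//; apply/eqP; rewrite -/(root _ _) root_prod_XsubC.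
rewrite scaler_sumr; under [RHS]eq_bigr do rewrite /v scaler_sumr.
rewrite exchange_big/=; apply: eq_bigr => w _.
rewrite (horner_coef q w) scaler_suml scaler_sumr; apply: eq_bigr => i _.
by rewrite !scalerA mulrC mulrAC.
Qed.

End FixedVectors.

End OddPart.
End GaloisGroup.
(** * Galois conjugates of the character *)

(** Here [c] numbers the cosets of [m] in [B]. Translation by x permutes them; comparing the sum of
    the representatives before and after leaves q times x in [m]. *)
Lemma coset_index_muln (V : zmodType) (B m : set V) (q : nat) (c : V -> nat) :
  (forall x y, B x -> B y -> B (x + y)) ->
  m 0 -> (forall x y, m x -> m y -> m (x + y)) -> (forall x, m x -> m (- x)) ->
  (forall x, B x -> (c x < q)%N) ->
  (forall i : 'I_q, exists2 x, B x & c x = i) ->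
  (forall x y, B x -> B y -> c x = c y <-> m (x - y)) ->
  forall x, B x -> m (x *+ q).
Proof.
move=> BD m0 mD mN c_lt c_surj cE x Bx.
have /choice[r rE] (i : 'I_q) : exists y, B y /\ c y = i.
  by have [y By yi] := c_surj i; exists y.
have Bri i : B (r i + x) by apply: BD => //; exact: (rE i).1.
pose u i := Ordinal (c_lt _ (Bri i)).
have uI : injective u.
  move=> i k /(congr1 val) /= /cE => /(_ (Bri i) (Bri k)).
  rewrite opprD addrACA subrr addr0 => /cE => /(_ (rE i).1 (rE k).1).
  by rewrite (rE i).2 (rE k).2 => /ord_inj.
have mu i : m (r (u i) - (r i + x)).
  by apply/cE => //; [exact: (rE _).1|rewrite (rE _).2].
have : m (\sum_i (r (u i) - (r i + x))).
  by elim/big_ind: _.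
rewrite sumrB big_split/= sumr_const card_ord.
rewrite -(reindex_inj uI (op := +%R) (P := predT) (F := r)).
by rewrite opprD addrA subrr sub0r => /mN; rewrite opprK.
Qed.

(** * Valuation balls and the residue characteristic *)

Section DiscreteValuation.
Variables (F : topFieldType) (v : F -> int).
Hypothesis v_val : discrete_valuation v.

Lemma valM x y : x != 0 -> y != 0 -> v (x * y) = v x + v y.
Proof. by have [_ h _] := v_val; exact: h. Qed.

Lemma val1 : v 1 = 0.
Proof.
by apply: (@addrI _ (v 1)); rewrite -valM ?oner_neq0// mulr1 addr0.
Qed.

Lemma valN x : x != 0 -> v (- x) = v x.
Proof.
have N1 : - 1 != 0 :> F by rewrite oppr_eq0 oner_neq0.
have : v (- 1) + v (- 1) = 0 by rewrite -valM// mulrNN mulr1 val1.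
by move=> h x0; rewrite -mulN1r valM//; lia.
Qed.

Lemma valV x : x != 0 -> v x^-1 = - v x.
Proof.
move=> x0; apply/eqP; rewrite -addr_eq0 -valM ?invr_eq0// mulVf// val1.
by rewrite eqxx.
Qed.

Lemma vball0 n : vball v n 0. Proof. by left. Qed.

Lemma vballN n x : vball v n x -> vball v n (- x).
Proof.
have [->|x0] := eqVneq x 0; first by rewrite oppr0.
by case=> [/eqP|nx]; [rewrite (negPf x0)|right; rewrite valN].
Qed.

Lemma vballD n x y : vball v n x -> vball v n y -> vball v n (x + y).
Proof.
have [->|x0] := eqVneq x 0; first by rewrite add0r.
have [->|y0] := eqVneq y 0; first by rewrite addr0.
have [_ _ vD] := v_val.
have [->|xy0] := eqVneq (x + y) 0; first by left.
case=> [/eqP|nx]; first by rewrite (negPf x0).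
case=> [/eqP|ny]; first by rewrite (negPf y0).
by right; apply: le_trans (vD x y x0 y0 xy0); rewrite le_min nx ny.
Qed.

Lemma vballM n k x y : vball v n x -> vball v k y -> vball v (n + k) (x * y).
Proof.
have [->|x0] := eqVneq x 0; first by rewrite mul0r; left.
have [->|y0] := eqVneq y 0; first by rewrite mulr0; left.
case=> [/eqP|nx]; first by rewrite (negPf x0).
case=> [/eqP|ny]; first by rewrite (negPf y0).
by right; rewrite valM// lerD.
Qed.

Lemma vballS n k x : k <= n -> vball v n x -> vball v k x.
Proof. by move=> kn [->|nx]; [left|right; exact: le_trans nx]. Qed.

Lemma vball_nat n : vball v 0 n%:R.
Proof.
elim: n => [|n IH]; first by left.
by rewrite -natr1; apply: vballD => //; right; rewrite val1.
Qed.

Lemma vball1N1 : ~ vball v 1 1.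
Proof. by case=> [/eqP|]; rewrite ?oner_eq0// val1. Qed.

Lemma vball_residue q :
  ([set [set x + y | y in vball v 1] | x in vball v 0] #= `I_q)%card ->
  vball v 1 q%:R.
Proof.
move=> /card_set_bijP[c [c_lt c_inj c_surj]].
pose cl x := [set x + y | y in vball v 1].
have clE x y : cl x = cl y <-> vball v 1 (x - y).
  split=> [e|xy].
    have : cl x x by exists 0; [exact: vball0|rewrite addr0].
    by rewrite e => -[z mz <-]; rewrite addrAC subrr add0r.
  apply/seteqP; split=> [_ [z mz <-]|_ [z mz <-]].
    by exists (x - y + z); [exact: vballD|rewrite addrA (addrC y) subrK].
  exists (y - x + z); last by rewrite addrA (addrC x) subrK.
  by rewrite -(opprB x); apply: vballD => //; exact: vballN.
have := @coset_index_muln F (vball v 0) (vball v 1) q (fun x => c (cl x)).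
move=> /(_ (@vballD 0) (vball0 1) (@vballD 1) (@vballN 1)); apply.
- by move=> x Bx; apply: c_lt; exists x.
- by move=> i; have [_ [x Bx <-] ci] := c_surj i (ltn_ord i); exists x.
- move=> x y Bx By; rewrite -clE; split=> [|->//].
  by apply: c_inj; apply/mem_set; [exists x|exists y].
- exact: (vball_nat 1).
Qed.

Lemma vball_prime p f : vball v 1 (p ^ f)%:R -> vball v 1 p%:R.
Proof.
have [->|p0] := eqVneq (p%:R : F) 0; first by left.
rewrite natrX => -[/eqP|]; first by rewrite expf_eq0 (negPf p0) andbF.
have -> : v (p%:R ^+ f) = (v p%:R) *+ f.
  elim: f => [|f IH]; first by rewrite expr0 val1.
  by rewrite exprS valM ?expf_neq0// IH mulrS.
move=> h; right; case: (lerP 1 (v p%:R)) => // lt1.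
have : v p%:R *+ f <= 0 by apply: mulrn_wle0; lia.
by lia.
Qed.

Lemma vball_primeX p k : vball v 1 p%:R -> vball v k%:Z (p%:R ^+ k).
Proof.
move=> vp; elim: k => [|k IH]; first exact: (vball_nat 1).
by rewrite exprS -add1n PoszD; exact: vballM.
Qed.

(** Integers that are close p-adically are close in F; this turns compatible exponents modulo p^k
    into Cauchy sequences. *)
Lemma vball_modn p k i j : vball v 1 p%:R -> i = j %[mod p ^ k] ->
  vball v k%:Z (i%:R - j%:R).
Proof.
move=> vp ij; rewrite {1}(divn_eq i (p ^ k)) {1}(divn_eq j (p ^ k)) ij.
rewrite !natrD opprD addrACA subrr addr0 !natrM -mulrBl natrX -[k%:Z]add0r.
apply: vballM; last exact: vball_primeX.
by apply: vballD; [|apply: vballN]; exact: vball_nat.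
Qed.

End DiscreteValuation.

(** * Existence, uniqueness and continuity of the factor b_g *)

Section CharacterConjugates.
Variables (F : topFieldType) (K : fieldType) (psi : smooth_character F K).
Hypothesis psi_nontrivial : exists x, psi x != 1.
Variables (p : nat) (p_prime : prime p).
Variables (R0 : fieldType) (iota : {rmorphism R0 -> K}).

Definition dilates_character (g : K -> K) (b : F) := forall x, g (psi x) = psi (b * x).

Lemma schar_natM n x : psi (n%:R * x) = psi x ^+ n.
Proof.
elim: n => [|n IH]; first by rewrite mul0r schar0 expr0.
by rewrite -natr1 mulrDl mul1r scharD IH exprSr.
Qed.

Lemma schar_neq0 x : psi x != 0.
Proof.
apply/eqP => px; have := schar0 psi.
by rewrite -(subrr x) scharD px mul0r => /esym/eqP; rewrite oner_eq0.
Qed.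

(** For distinct b and c the products (b - c)x exhaust F, and psi would be trivial. *)
Lemma schar_dilation_inj b c : (forall x, psi (b * x) = psi (c * x)) -> b = c.
Proof.
move=> bc; apply/eqP; rewrite -subr_eq0; apply/negPn/negP => bc0.
have [x /eqP] := psi_nontrivial; apply.
have -> : x = (b - c) * (x / (b - c)) by rewrite mulrCA mulfV// mulr1.
rewrite mulrBl scharD bc -scharD -mulrBl mulrC.
by rewrite subrr mulr0 schar0.
Qed.

Lemma dilates_character_fixed g b z N : dilates_character g b ->
  galois_group iota g -> N.-primitive_root z -> g z = z ->
  forall x, psi x ^+ N = 1 -> psi (b * x) = psi x.
Proof.
by move=> gb Gg zN gz x xN; rewrite -gb (fixed_root_of_unity Gg zN gz xN).
Qed.

Definition dilates_all :=
  forall g, galois_group iota g -> exists b, dilates_character g b.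

(** Continuity at the identity of g -> b_g for the Krull topology, with neighbourhoods given by
    stabilisers of one root of unity. *)
Definition dilates_continuously :=
  forall P, nbhs (1 : F) P -> exists k (z : K), (p ^ k)%N.-primitive_root z /\
    forall g b, galois_group iota g -> dilates_character g b -> g z = z -> P b.

(** As F is killed by p, the values of psi are p-th roots of unity: b is the image of the exponent
    of g on them, and b = 1 as soon as g fixes a primitive one. *)
Lemma dilates_pchar : p%:R = 0 :> F -> cyclotomic_extension iota p [set 1%N] ->
  dilates_all /\ dilates_continuously.
Proof.
move=> p0 K_cyclo; have [z zp] := K_cyclo.1 1%N erefl.
have psip x : psi x ^+ (p ^ 1)%N = 1.
  by rewrite expn1 -schar_natM p0 mul0r schar0.
split=> [g Gg|P P1].
  have [e ge] := galois_root_of_unity Gg zp.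
  by exists e%:R => x; rewrite ge// schar_natM.
exists 1%N, z; split=> // g b Gg gb gz.
have -> : b = 1; last exact: nbhs_singleton.
apply: schar_dilation_inj => x; rewrite mul1r.
exact: (dilates_character_fixed gb Gg zp gz).
Qed.

Section CharacteristicZero.
Variable v : F -> int.
Hypothesis v_val : discrete_valuation v.
Hypothesis v_nbhs : forall P : set F, nbhs (0 : F) P <-> exists n, vball v n `<=` P.
Hypothesis F_complete : forall u : nat -> F,
  (forall n : int, exists N : nat, forall i j : nat,
     (N <= i)%N -> (N <= j)%N -> vball v n (u i - u j)) ->
  exists l : F, u @ \oo --> l.
Hypothesis vp : vball v 1 p%:R.
Hypothesis p_neq0 : p%:R != 0 :> F.
Hypothesis K_cyclo : cyclotomic_extension iota p setT.

Lemma schar_kernel_ball : exists n, forall x, vball v n x -> psi x = 1.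
Proof.
have /v_nbhs[n nP] := schar_lc psi 0.
by exists n => x /nP; rewrite /= schar0.
Qed.

Lemma schar_torsion x : exists k, forall i, (k <= i)%N -> psi x ^+ (p ^ i)%N = 1.
Proof.
have [n nP] := schar_kernel_ball.
exists (absz (n - v x)%R) => i ki; rewrite -schar_natM natrX; apply: nP.
have [->|x0] := eqVneq x 0; first by rewrite mulr0; left.
apply: (@vballS _ v (i%:Z + v x)); first by lia.
by apply: (vballM v_val); [exact: vball_primeX|right].
Qed.

(** The exponents [e k] of g on roots of unity of order p^k are compatible, so they converge in F; b
    is the limit. Each [psi x] is torsion of p-power order, so for large i its image under g is
    [psi ((e i)%:R * x)], which equals [psi (b * x)] by local constancy. *)
Lemma dilates_all_char0 : dilates_all.
Proof.
move=> g Gg.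
have /choice[e ge] k : exists a, forall x : K, x ^+ (p ^ k)%N = 1 -> g x = x ^+ a.
  by have [z zk] := K_cyclo.1 k I; exact: galois_root_of_unity Gg zk.
have e_mod k i : (k <= i)%N -> e i = e k %[mod p ^ k].
  move=> ki; have [z zk] := K_cyclo.1 k I.
  have z1 := prim_expr_order zk.
  apply/eqP; rewrite -(eq_prim_root_expr zk) -!ge// -(subnKC ki) expnD.
  by rewrite exprM z1 expr1n.
have [|b eb] := F_complete (u := fun k => (e k)%:R).
  move=> n; exists `|n|%N => i k ni nk.
  apply: (@vballS _ v (`|n|%N)%:Z); first by lia.
  apply: (@vball_modn _ _ v_val p) => //.
  by rewrite (e_mod _ _ ni) (e_mod _ _ nk).
exists b => x.
have ebx : (fun k => (e k)%:R * x) @ \oo --> b * x.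
  apply: (cvg_comp _ (fun y : F => y * x) eb).
  apply: (@continuousMf F F id (fun=> x)); last exact: cst_continuous.
  by move=> y; exact: cvg_id.
have [k kx] := schar_torsion x.
have near_eq : \forall i \near \oo, psi ((e i)%:R * x) = psi (b * x).
  exact: (ebx _ (schar_lc psi (b * x))).
have near_k : \forall i \near \oo, (k <= i)%N by exact: nbhs_infty_ge.
have [i [ki ie]] : exists i, (k <= i)%N /\ psi ((e i)%:R * x) = psi (b * x).
  by apply: (@filter_ex _ \oo); apply: filterI.
by rewrite -ie schar_natM; apply: ge; exact: kx.
Qed.

(** If g fixes z, then psi((b - 1)x) = 1 for every x such that psi x is killed by p^k. Were b - 1
    not small, x = x0 / (b - 1) would be such an x, contradicting psi x0 != 1. *)
Lemma dilates_continuously_char0 : dilates_continuously.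
Proof.
move=> P P1.
have /v_nbhs[n nP] : nbhs (0 : F) [set c | P (1 + c)].
  have c1 : continuous (fun c : F => 1 + c).
    apply: (@continuousDf F F (fun=> 1) id) => [|y]; first exact: cst_continuous.
    exact: cvg_id.
  by apply: (c1 0); rewrite addr0.
have [x0 px0] := psi_nontrivial; have [m mP] := schar_kernel_ball.
have x00 : x0 != 0 by apply: contraNneq px0 => ->; rewrite schar0.
(* If v(b - 1) < n, this k gives p^k x0 / (b - 1) valuation at least m, so that it lies in the
   kernel of psi. *)
pose k := absz (n + m - v x0)%R; have [z zk] := K_cyclo.1 k I.
exists k, z; split=> // g b Gg gb gz.
suff : vball v n (b - 1) by move=> /nP /=; rewrite addrC subrK.
have [->|c0] := eqVneq (b - 1) 0; first exact: vball0.
pose x := x0 / (b - 1).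
have psix : psi (p%:R ^+ k * x) != 1.
  rewrite -natrX schar_natM; apply: contraNneq px0 => xk.
  have := dilates_character_fixed gb Gg zk gz xk.
  rewrite -[b](subrK 1) mulrDl mul1r scharD -[RHS]mul1r => /(mulIf (schar_neq0 _)).
  by rewrite /x mulrC divfK// => ->.
have x_neq0 : x != 0 by rewrite mulf_neq0// invr_neq0.
have pk0 : p%:R ^+ k != 0 :> F by rewrite expf_neq0.
have [//|] := pselect (vball v n (b - 1)).
move=> nb; case/eqP: psix; apply: mP; right.
have [/eqP|vpk] := vball_primeX v_val k vp; first by rewrite (negPf pk0).
rewrite valM// /x valM ?invr_neq0// valV//.
have : (v (b - 1) < n)%R by rewrite ltNge; apply/negP => nb'; apply: nb; right.
by lia.
Qed.

End CharacteristicZero.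

(** The cases are separated by whether p vanishes in F. If it does not, F cannot be finite, since
    p^f kills a field with p^f elements; so F is local, and of characteristic 0. *)
Lemma character_conjugates f :
  finite_field F (p ^ f) \/ local_field F (p ^ f) -> coefficient_field F p iota ->
  exists A, [/\ cyclotomic_extension iota p A, dilates_all & dilates_continuously].
Proof.
move=> F_fin_or_loc [K_char0 K_charp].
have [p0|p0] := eqVneq (p%:R : F) 0.
  have pF : p \in [pchar F] by rewrite inE p_prime p0 eqxx.
  have K_cyclo := K_charp p pF.
  by exists [set 1%N]; have [] := dilates_pchar p0 K_cyclo.
case: F_fin_or_loc => [[/card_set_bijP[c [c_lt c_inj c_surj]] _]|].
  have : [set 0 : F] (1 *+ (p ^ f)).
    apply: (@coset_index_muln F setT [set 0] (p ^ f) c) => //=.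
    - by move=> x y -> ->; rewrite addr0.
    - by move=> x ->; rewrite oppr0.
    - by move=> i; have [x _ xi] := c_surj i (ltn_ord i); exists x.
    move=> x y _ _; split=> [xy|/eqP].
      by rewrite (c_inj x y) ?inE// subrr.
    by rewrite subr_eq0 => /eqP ->.
  by rewrite /= natrX => /eqP; rewrite expf_eq0 (negPf p0) andbF.
move=> [v [v_val v_nbhs F_complete /(vball_residue v_val)/(vball_prime v_val) vp]].
have K_cyclo : cyclotomic_extension iota p setT.
  (* If a prime l vanished in F, Bezout's identity for p and l would make 1 an integral multiple of
     p, of valuation at least 1. *)
  apply: K_char0 => l; rewrite [RHS]inE; apply/negP => /andP[l_prime /eqP l0].
  have pl : coprime p l.
    rewrite prime_coprime// dvdn_prime2//.
    by apply: contraNneq p0 => ->; rewrite l0.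
  have [a _ /dvdnP[q]] := Bezoutl l (prime_gt0 p_prime).
  rewrite (eqP pl) => /(congr1 (fun n => n%:R : F)).
  rewrite natrD !natrM l0 mulr0 addr0 => e.
  apply: (vball1N1 v_val).
  suff : vball v (0 + 1) (q%:R * p%:R) by rewrite -e add0r.
  by apply: (vballM v_val) => //; exact: vball_nat.
exists setT; split=> //.
  exact: (dilates_all_char0 v_val v_nbhs F_complete vp p0 K_cyclo).
exact: (dilates_continuously_char0 v_val v_nbhs vp p0 K_cyclo).
Qed.

End CharacterConjugates.
(** * The rational structure *)

Section RestrictionOfScalars.
Variables (L K : fieldType) (j : {rmorphism L -> K}) (S : lmodType K).
Variable P : S -> Prop.
Hypothesis P0 : P 0.
Hypothesis PZD : forall a v w, P v -> P w -> P (j a *: v + w).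

(** A synonym of [S], so that scaling by L through [j] does not compete with scaling by K. *)
Definition restriction : Type := S.
HB.instance Definition _ := GRing.Zmodule.on restriction.

Let scale (a : L) (v : restriction) : restriction := j a *: (v : S).

Fact restriction_scaleA a b v : scale a (scale b v) = scale (a * b) v.
Proof. by rewrite /scale scalerA rmorphM. Qed.
Fact restriction_scale1 : left_id 1 scale.
Proof. by move=> v; rewrite /scale rmorph1 scale1r. Qed.
Fact restriction_scaleDr : right_distributive scale +%R.
Proof. by move=> a v w; exact: scalerDr. Qed.
Fact restriction_scaleDl v : {morph scale^~ v : a b / a + b}.
Proof. by move=> a b; rewrite /scale rmorphD scalerDl. Qed.
HB.instance Definition _ := GRing.Zmodule_isLmodule.Build L restriction
  restriction_scaleA restriction_scale1 restriction_scaleDr restriction_scaleDl.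

Definition submodule_pred : {pred restriction} := fun v => `[< P v >].

Record submodule := Submodule {
  submodule_val :> restriction;
  _ : submodule_pred submodule_val
}.
HB.instance Definition _ := [isSub for submodule_val].
HB.instance Definition _ := [Choice of submodule by <:].

Fact submodule_closed : submod_closed submodule_pred.
Proof.
split=> [|a v w /asboolP Pv /asboolP Pw]; apply/asboolP; first exact: P0.
exact: PZD.
Qed.
HB.instance Definition _ :=
  GRing.isSubmodClosed.Build L restriction submodule_pred submodule_closed.
HB.instance Definition _ := [SubChoice_isSubLmodule of submodule by <:].

Lemma submodule_exists : exists (V : lmodType L) (i : V -> S),
  [/\ injective i, {morph i : v w / v + w},
      forall a v, i (a *: v) = j a *: i v &
      forall f, P f <-> exists v, f = i v].
Proof.
exists submodule, submodule_val; split=> //; first exact: val_inj.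
move=> f; split=> [Pf|[v ->]]; last by have /asboolP := valP v.
by exists (Submodule (asboolT Pf : submodule_pred f)).
Qed.

End RestrictionOfScalars.

(** * Commutation of the semilinear twists with the Weil representation *)

Section Commutation.
Variables (F : topFieldType) (W : vectType F) (form : {skew_symmetric W}).
Variables (X Y : {vspace W}) (K : fieldType) (psi : smooth_character F K).
Variables (Mp : topGroupType) (pr : Mp -> 'End(W)) (eps : Mp) (s : 'End(W) -> Mp).
Local Notation S := (schwartz (subvs_of Y) K).
Local Notation rho := (heisenberg_rep form X psi).
Variable omega : Mp -> S -> S.
Hypothesis two0 : 2%:R != 0 :> F.
Hypothesis W_nonzero : (0 < \dim {:W})%N.
Hypothesis form_sympl : is_psymplectic form.
Hypothesis XY_pol : complete_polarisation form X Y.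
Hypothesis psi_nontrivial : exists x, psi x != 1.
Hypothesis Mp_meta : metaplectic form X pr eps s.
Hypothesis omega_weil : weil_representation form X pr eps s psi omega.
Variables (b : F) (b0 : b != 0).
Variables (g : {rmorphism K -> K}) (g' : K -> K) (gK : cancel g g') (g'K : cancel g' g).
Hypothesis g_psi : forall x, g (psi x) = psi (b * b * x).
Variables (T T' : S -> S).
Hypothesis TE : forall (f : S) y, T f y = g (f (b^-1 *: y)).
Hypothesis T'E : forall (f : S) y, T' f y = g' (f (b *: y)).
Implicit Types f : S.

Let TK : cancel T T'.
Proof.
by move=> f; apply: schwartz_eqP => y; rewrite T'E TE scalerA mulVf// scale1r gK.
Qed.

Let T'K : cancel T' T.
Proof.
by move=> f; apply: schwartz_eqP => y; rewrite TE T'E scalerA mulfV// scale1r g'K.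
Qed.

Let TD : {morph T : f h / f + h}.
Proof.
by move=> f h; apply: schwartz_eqP => y; rewrite schwartzD !TE schwartzD rmorphD.
Qed.

Let TZ c f : T (c *: f) = g c *: T f.
Proof. by apply: schwartz_eqP => y; rewrite schwartzZ !TE schwartzZ rmorphM. Qed.

Let omega_linear a : linear (omega a).
Proof. by have [[[h _ _] _] _ _ _] := omega_weil; exact: h. Qed.

Let omegaM a a' f : omega (a * a')%g f = omega a (omega a' f).
Proof. by have [[[_ _ h] _] _ _ _] := omega_weil; exact: h. Qed.

Let omega1 f : omega 1%g f = f.
Proof. by have [[[_ h _] _] _ _ _] := omega_weil; exact: h. Qed.

Let omegaD a : {morph omega a : f h / f + h}.
Proof. by move=> f h; have := omega_linear a 1 f h; rewrite !scale1r. Qed.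

Let omegaZ a c f : omega a (c *: f) = c *: omega a f.
Proof.
have o0 : omega a 0 = 0 by apply: (@addrI _ (omega a 0)); rewrite -omegaD !addr0.
by have := omega_linear a c f 0; rewrite o0 !addr0.
Qed.

Let omegaVK a f : omega (a^-1)%g (omega a f) = f.
Proof. by rewrite -omegaM mulVg omega1. Qed.

Let omega_rho a h f : omega a (rho h f) = rho (pr a h.1, h.2) (omega a f).
Proof.
have [_ _ h3 _] := omega_weil.
by rewrite -h3 omegaVK.
Qed.

Let T_rho h f : T (rho h f) = rho (b *: h.1, b * b * h.2) (T f).
Proof.
apply: schwartz_eqP => y; rewrite TE /= /heisenberg_fun/=.
rewrite /xpart /ypart !linearZ /= -/(xpart X Y h.1) -/(ypart X Y h.1) TE.
rewrite !rmorphM /= !g_psi; congr (_ * psi _ * g (f _)).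
  by rewrite !skewZl; field; rewrite b0 two0.
by rewrite scalerDr scalerA mulVf// scale1r.
Qed.

Let T'_rho h f : T' (rho (b *: h.1, b * b * h.2) f) = rho h (T' f).
Proof. by rewrite -{1}[f]T'K -T_rho TK. Qed.

Let T'D : {morph T' : f h / f + h}.
Proof. by move=> f h; rewrite -{1}[f]T'K -{1}[h]T'K -TD TK. Qed.

Let T'Z c f : T' (g c *: f) = c *: T' f.
Proof. by rewrite -{1}[f]T'K -TZ TK. Qed.

(* T^-1 omega(a) T omega(a)^-1 is K-linear and commutes with rho. *)
Lemma twist_projective a : exists c, forall f, omega a (T f) = c *: T (omega a f).
Proof.
have [|||c cE] := @schur F W form X Y K psi XY_pol psi_nontrivial
  (fun f => T' (omega a (T (omega (a^-1)%g f)))).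
- by move=> f h; rewrite omegaD TD omegaD T'D.
- by move=> c f; rewrite omegaZ TZ omegaZ T'Z.
- move=> h f; rewrite omega_rho T_rho omega_rho/= -T'_rho; congr (T' (rho (_, _) _)).
  rewrite linearZ /= -comp_lfunE -(mp_prM Mp_meta) mulgV.
  by rewrite (pr1 Mp_meta) id_lfunE.
exists (g c) => f; rewrite -TZ -[in RHS](cE (omega a f)) T'K omegaVK.
by [].
Qed.

(** The scalar of [twist_projective] need only be controlled on generators, where [omega] is
    explicit. On N(X) the phase is quadratic in y, so the dilation by the inverse of b is
    compensated by the factor b^2 coming from [g_psi]. *)
Lemma twist_commutes a f : omega a (T f) = T (omega a f).
Proof.
have [_ /eqP lX _ _] := XY_pol.
move: a f; apply: (metaplectic_ind two0 W_nonzero form_sympl _ Mp_meta).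
- by have [h _ _ _] := XY_pol.
- have [_ oeps _ _] := omega_weil.
  by move=> f; rewrite !oeps -[in RHS]scaleN1r TZ rmorphN1 scaleN1r.
- by move=> a a' Ma Ma' f; rewrite !omegaM Ma' Ma.
- move=> a a' Ma' f; have [c cE] := twist_projective a.
  have [d dE] := twist_projective (a^-1)%g.
  (* The scalars attached to [a] and to its inverse cancel, so conjugation preserves commutation. *)
  have cd h : (d * c) *: T h = T h.
    rewrite -[in RHS](omega1 (T h)) -(mulgV a) omegaM dE omegaZ cE scalerA.
    by rewrite -omegaM mulgV omega1.
  by rewrite !omegaM dE !omegaZ Ma' cE scalerA cd.
move=> n nX f; apply: schwartz_eqP => y; have [_ _ _ on] := omega_weil.
rewrite on// !TE on// rmorphM g_psi; congr (psi _ * _).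
rewrite [vsval (b^-1 *: y)]linearZ /=.
have -> : n (b^-1 *: vsval y) - b^-1 *: vsval y = b^-1 *: (n (vsval y) - vsval y).
  by rewrite linearZ scalerBr.
by rewrite skewZl skewZr; field; rewrite b0 two0.
Qed.

End Commutation.

Theorem theorem7p1
  (* the base field F, of characteristic not 2 *)
  (p f : nat) (F : topFieldType)
  (p_prime : prime p) (p_neq2 : p != 2%N)
  (F_char : 2%N \notin [pchar F])
  (F_fin_or_loc : finite_field F (p ^ f) \/ local_field F (p ^ f))
  (* R_0 = Q or F_l with l <> p, and the coefficient field K *)
  (l : option nat) (l_prime : forall l', l = Some l' -> prime l' && (l' != p))
  (K : fieldType) (iota : {rmorphism prime_field l -> K})
  (K_cyclo : coefficient_field F p iota)
  (* L is the fixed field of the factor G2' of Gal(K/R_0) = G2 x G2' *)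
  (G2 G2' : set (K -> K)) (G_dec : decomposition_2_2' iota G2 G2')
  (L : fieldType) (j : {rmorphism L -> K}) (L_fix : range j = fixed_field G2')
  (* a non-trivial smooth character of F *)
  (psi : smooth_character F K) (psi_nontrivial : exists x, psi x != 1)
  (* a nonzero symplectic space W with a complete polarisation W = X + Y *)
  (W : vectType F) (form : {skew_symmetric W}) (X Y : {vspace W})
  (W_nonzero : (0 < \dim {:W})%N) (form_sympl : is_psymplectic form)
  (XY_pol : complete_polarisation form X Y)
  (* the metaplectic group and the Weil representation *)
  (Mp : topGroupType) (pr : Mp -> 'End(W)) (eps : Mp) (s : 'End(W) -> Mp)
  (Mp_meta : metaplectic form X pr eps s)
  (omega : Mp -> schwartz (subvs_of Y) K -> schwartz (subvs_of Y) K)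
  (omega_weil : weil_representation form X pr eps s psi omega) :
  exists (V : lmodType L) (pi : Mp -> V -> V),
    smooth_representation pi /\
    extension_of_scalars_isomorphic j pi omega.
Proof.
have two0 : 2%:R != 0 :> F by apply: contra F_char => /eqP h; rewrite inE /= h eqxx.
have [A [K_cyc dil_all dil_cont]] :=
  character_conjugates psi_nontrivial p_prime F_fin_or_loc K_cyclo.
have [[_ H_sub _ _ _] [_ H_odd]] := G_dec.
have [[H1 HM HV] HG _] := H_sub.
have /choice[b bE] (g : K -> K) : exists c, G2' g -> dilates_character psi g c.
  have [Hg|] := pselect (G2' g); last by exists 0.
  by have [c gc] := dil_all g (HG g Hg); exists c.
have b0 g : G2' g -> b g != 0.
  move=> Hg; apply/eqP => bg0; have [x /eqP] := psi_nontrivial; apply.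
  have [h gh] := galois_rmorphism (HG g Hg).
  have := bE g Hg x; rewrite bg0 mul0r schar0 gh => /eqP.
  by rewrite fmorph_eq1 => /eqP.
have bM g h : G2' g -> G2' h -> b (g \o h) = b g * b h.
  move=> Hg Hh; apply: (schar_dilation_inj psi_nontrivial) => x.
  by rewrite -(bE _ (HM g h Hg Hh)) /= (bE h)// (bE g)// mulrA.
pose S := schwartz (subvs_of Y) K.
have /choice[R RE] (g : K -> K) : exists Rg : S -> S,
    G2' g -> forall (f : S) y, Rg f y = g (g (f ((b g)^-1 *: y))).
  have [Hg|] := pselect (G2' g); last by exists id.
  have gg0 : (g \o g) 0 = 0.
    by have [h gh] := galois_rmorphism (HG g Hg); rewrite gh /= !rmorph0.
  by exists (schwartz_twist gg0 (b0 g Hg)) => _ f0 y.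
have RD g : G2' g -> {morph R g : v w / v + w}.
  move=> Hg v w; apply: schwartz_eqP => y; have [h gh] := galois_rmorphism (HG g Hg).
  by rewrite schwartzD !RE// schwartzD gh !rmorphD.
have RZ g c v : G2' g -> R g (c *: v) = g (g c) *: R g v.
  move=> Hg; apply: schwartz_eqP => y; have [h gh] := galois_rmorphism (HG g Hg).
  by rewrite schwartzZ !RE// schwartzZ gh !rmorphM.
have RM g h v : G2' g -> G2' h -> R (g \o h) v = R g (R h v).
  move=> Hg Hh; apply: schwartz_eqP => y.
  rewrite !RE//; last exact: HM.
  rewrite bM// invfM scalerA [_ * (b h)^-1]mulrC /=.
  by rewrite -[h (g _)](galois_abelian K_cyc _ (HG g Hg) (HG h Hh)).
have omegaR g a u : G2' g -> omega a (R g u) = R g (omega a u).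
  move=> Hg; have [h gh] := galois_rmorphism (HG g Hg).
  have [k [Hk gk kg]] := HV g Hg.
  have [T' T'E] : exists T' : S -> S, forall (f : S) y, T' f y = k (k (f (b g *: y))).
    have kk0 : (k \o k) 0 = 0.
      by have [k' kk'] := galois_rmorphism (HG k Hk); rewrite kk' /= !rmorph0.
    have bV0 : (b g)^-1 != 0 by rewrite invr_eq0 b0.
    by exists (schwartz_twist kk0 bV0) => f' y; rewrite /= invrK.
  apply: (@twist_commutes F W form X Y K psi Mp pr eps s omega two0 W_nonzero
    form_sympl XY_pol psi_nontrivial Mp_meta omega_weil (b g) (b0 g Hg)
    (h \o h) (k \o k) _ _ _ (R g) T').
  - by move=> x; rewrite /= -gh !gk.
  - by move=> x; rewrite /= -gh !kg.
  - by move=> x; rewrite /= -gh !bE// mulrA.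
  - by move=> f' y; rewrite RE// gh.
  - exact: T'E.
pose fixed (f : S) := forall g, G2' g -> R g f = f.
have fix_j a g : G2' g -> g (j a) = j a.
  have : fixed_field G2' (j a) by rewrite -L_fix; exists a.
  by apply.
have R0 g : G2' g -> R g 0 = 0.
  by move=> Hg; apply: (@addrI _ (R g 0)); rewrite -RD// !addr0.
have [//||V [i [i_inj iD iZ iP]]] := @submodule_exists L K j S fixed.
  by move=> a v w vf wf g Hg; rewrite RD// RZ// !fix_j// vf// wf.
(* One root z controls both effects of [R g]: if g fixes z, then [b g] is so close to 1 that
   dilation leaves [f0] unchanged, and g fixes the finitely many values of [f0]. *)
have smooth_R (f0 : S) : exists k (z : K), (p ^ k)%N.-primitive_root z /\
    forall g, G2' g -> g z = z -> R g f0 = f0.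
  have [k1 [z1 [_ z1P]]] := dil_cont _ (schwartz_dilation_near f0).
  have [vs vsP] := schwartz_finite_values f0.
  have [k [z [zk zP]]] := stabiliser_of_seq K_cyc (z1 :: vs).
  exists k, z; split=> // g Hg gz; have gfix := zP g (HG g Hg) gz.
  have dil := z1P g (b g) (HG g Hg) (bE g Hg) (gfix z1 (mem_head _ _)) (b0 g Hg).
  apply: schwartz_eqP => y; rewrite RE// -(dil ((b g)^-1 *: y)) scalerA.
  rewrite mulfV ?b0// scale1r; have gf : g (f0 y) = f0 y.
    have [->|fy] := eqVneq (f0 y) 0; last by rewrite gfix// inE vsP// orbT.
    by have [h gh] := galois_rmorphism (HG g Hg); rewrite gh rmorph0.
  by rewrite !gf.
have [[[omega_lin omega1 omegaM] omega_smooth] _ _ _] := omega_weil.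
(* Commuting with all [R g], [omega] preserves the fixed vectors; [pi] is its restriction to
   them. *)
have /choice[pi piE] (av : Mp * V) : exists w, omega av.1 (i av.2) = i w.
  apply/iP => g Hg; rewrite -omegaR//; congr (omega _ _).
  by apply: (iP (i av.2)).2 => //; exists av.2.
have i_pi a v : i (pi (a, v)) = omega a (i v) by rewrite (piE (a, v)).
have omegaZD a c v w : omega a (c *: v + w) = c *: omega a v + omega a w.
  exact: omega_lin.
exists V, (fun a v => pi (a, v)); split.
  split; first split=> [a c v w|v|a a' v]; try apply: i_inj.
  - by rewrite iD iZ !i_pi iD iZ omegaZD.
  - by rewrite i_pi omega1.
  - by rewrite !i_pi omegaM.
  move=> v; have -> : [set a | pi (a, v) = v] = [set a | omega a (i v) = i v].
    apply/seteqP; split=> a /= h; first by rewrite -i_pi h.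
    by apply: i_inj; rewrite i_pi.
  exact: omega_smooth.
(* With [S] as tensor product, the extended action is [omega] and the required isomorphism is the
   identity. *)
exists S, (fun v c => c *: i v), omega; split; last by exists id; split=> //; exists id.
- apply: (@descent_tensor_product L K j V S i iD iZ i_inj {g | G2' g}
    (fun g => sval g \o sval g) (fun g => R (sval g))).
  + move=> [g Hg] /=; have [h gh] := galois_rmorphism (HG g Hg).
    by rewrite gh !rmorph0.
  + move=> [g Hg] /=; have [h gh] := galois_rmorphism (HG g Hg).
    by rewrite gh !rmorph1.
  + by move=> [g Hg]; exact: RD.
  + by move=> [g Hg] c f0; exact: RZ.
  + by move=> [g Hg] v; apply: (iP (i v)).2 => //; exists v.
  + move=> x xfix; have : fixed_field G2' x.
      move=> g Hg; apply: (odd_fix_square K_cyc H_sub H_odd Hg).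
      exact: (xfix (exist _ g Hg)).
    by rewrite -L_fix => -[a _ <-]; exists a.
  move=> f0; have [k [z [zk f0_fix]]] := smooth_R f0.
  have [n [v [c [v_fix ->]]]] :=
    span_fixed_vectors K_cyc H_sub H_odd RD RZ RM zk f0_fix.
  have /choice[w wE] m : exists w, v m = i w by apply/iP; exact: v_fix.
  exists [seq (w m, c m) | m <- index_iota 0 n].
  by rewrite big_map big_mkord; apply: eq_bigr => m _; rewrite wE.
- by split.
move=> a v c; rewrite i_pi -[c *: i v]addr0 omegaZD.
have := omegaZD a (- 1) 0 0; rewrite scaler0 addr0 scaleN1r addNr => ->.
by rewrite addr0.
Qed.
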